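(* Consider the diffusion recursion $\boldsymbol{\phi}_{k,i}=\boldsymbol{w}_{k,i-1}-\mu\,\widehat{\nabla J}_k(\boldsymbol{w}_{k,i-1})$, $\boldsymbol{w}_{k,i}=\sum_{\ell=1}^N a_{\ell k}\boldsymbol{\phi}_{\ell,i}$ under the assumptions listed in the context, with sufficiently small step-size $\mu>0$ and after sufficient iterations $i\ge i_o$. Let $\boldsymbol{w}_{c,i}=\sum_{k=1}^N p_k\boldsymbol{w}_{k,i}$ be the network centroid, and let $\mathcal{G},\mathcal{M}\subset\mathbb{R}^M$, $c_2$, $\pi$ be as defined in the context. Write $\pi_{i-1}^{\mathcal{G}}=\Pr\{\boldsymbol{w}_{c,i-1}\in\mathcal{G}\}$ and $\pi_{i-1}^{\mathcal{M}}=\Pr\{\boldsymbol{w}_{c,i-1}\in\mathcal{M}\}$. (1) If $\pi_{i-1}^{\mathcal{G}}\ne0$, then $$\mathbb{E}\{J(\boldsymbol{w}_{c,i})\,|\,\boldsymbol{w}_{c,i-1}\in\mathcal{G}\}\le\mathbb{E}\{J(\boldsymbol{w}_{c,i-1})\,|\,\boldsymbol{w}_{c,i-1}\in\mathcal{G}\}-\mu^2\frac{c_2}{\pi}+\frac{O(\mu^3)}{\pi_{i-1}^{\mathcal{G}}}.$$ (2) If $\pi_{i-1}^{\mathcal{M}}\ne0$, then $$\mathbb{E}\{J(\boldsymbol{w}_{c,i})\,|\,\boldsymbol{w}_{c,i-1}\in\mathcal{M}\}\le\mathbb{E}\{J(\boldsymbol{w}_{c,i-1})\,|\,\boldsymb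ol{w}_{c,i-1}\in\mathcal{M}\}+\mu^2c_2+\frac{O(\mu^3)}{\pi_{i-1}^{\mathcal{M}}}.$$
   Context: Setting. There are $N$ agents; agent $k$ has a twice-differentiable cost $J_k:\mathbb{R}^M\to\mathbb{R}$. $A=[a_{\ell k}]\in\mathbb{R}^{N\times N}$ is a combination matrix with $a_{\ell k}\ge0$, $\sum_{\ell}a_{\ell k}=1$ for every $k$, and $a_{\ell k}=0$ if $\ell$ is not a neighbor of $k$. $\widehat{\nabla J}_k(\cdot)$ is a stochastic approximation of $\nabla J_k(\cdot)$. $\boldsymbol{\mathcal{W}}_i=\mathrm{col}\{\boldsymbol{w}_{1,i},\dots,\boldsymbol{w}_{N,i}\}$, and $\boldsymbol{\mathcal{F}}_i$ is the filtration generated by $\boldsymbol{\mathcal{W}}_0,\dots,\boldsymbol{\mathcal{W}}_i$. Norms are Euclidean/spectral. Assumptions. (Strongly-connected graph) There is a path with nonzero weights between any two agents, and at least one agent has $a_{kk}>0$. Hence there is a unique Perron vector $p$ with $Ap=p$, $\mathbf{1}^{\mathsf T}p=1$, $p_k>0$. The aggregate cost is $J(w)=\sum_{k=1}^N p_kJ_k(w)$. (Lipschitz gradients) $\|\nabla J_k(x)-\nabla J_k(y)\|\le\delta\|x-y\|$ for all $k$ and $x,y\in\mathbb{R}^M$. (Bounded gradient disagreement) $\|\nabla J_k(x)-\nabla J_\ell(x)\|\le G$ for all $k,\ell$ and $x\in\mathbb{R}^M$. (Gradient noise) $\boldsymbol{s}_{k,i}(\boldsymbol{w}_{k,i-1})=\widehat{\nabla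 J}_k(\boldsymbol{w}_{k,i-1})-\nabla J_k(\boldsymbol{w}_{k,i-1})$ satisfies, for all $k$ and $i$, $\mathbb{E}\{\boldsymbol{s}_{k,i}(\boldsymbol{w}_{k,i-1})|\boldsymbol{\mathcal{F}}_{i-1}\}=0$ and $\mathbb{E}\{\|\boldsymbol{s}_{k,i}(\boldsymbol{w}_{k,i-1})\|^4|\boldsymbol{\mathcal{F}}_{i-1}\}\le\sigma^4$, and for $k\ne\ell$, $\mathbb{E}\{\boldsymbol{s}_{k,i}(\boldsymbol{w}_{k,i-1})\boldsymbol{s}_{\ell,i}(\boldsymbol{w}_{\ell,i-1})^{\mathsf T}|\boldsymbol{\mathcal{F}}_{i-1}\}=0$. Constants and sets. $c_1=\tfrac12(1-2\mu\delta)$, $c_2=\delta\sigma^2/2$; $0<\pi<1$ is a parameter (not depending on $\mu$) and $\tau>0$ is a small parameter. Then $\mathcal{G}=\{w:\|\nabla J(w)\|^2\ge\mu\frac{c_2}{c_1}(1+\frac1\pi)\}$, $\mathcal{G}^C$ is its complement, and $\mathcal{M}=\{w\in\mathcal{G}^C:\lambda_{\min}(\nabla^2J(w))>-\tau\}$. Sufficient iterations. $i_o=\log(o(\mu^4))/\log(\|J_\epsilon^{\mathsf T}\|)$, where $o(\mu^4)$ is a positive function of $\mu$ of higher order than $\mu^4$ as $\mu\to0$, and $J_\epsilon$ is the Jordan matrix of $A$ restricted to the eigenvalues $\lambda_2(A),\dots,\lambda_N(A)$ other than the eigenvalue one, with the ones off the diagonal replaced by a fixed $\epsilon>0$ (on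 the first lower sub-diagonal) small enough that $\|J_\epsilon^{\mathsf T}\|<1$. Asymptotic convention. $\mu$ is the only varying parameter; all other data (including the law of the initial iterate $\boldsymbol{\mathcal{W}}_0$, with $\mathbb{E}\|\boldsymbol{\mathcal{W}}_0\|^4<\infty$) are held fixed. $O(\mu^3)$ denotes a quantity bounded in absolute value by $C\mu^3$ for all sufficiently small $\mu$, with $C$ independent of $\mu$, of $i\ge i_o$ and of the probabilities $\pi_{i-1}^{\mathcal{G}},\pi_{i-1}^{\mathcal{M}}$.
   Formalization: When ‖J_ε^T‖ = 0 (one agent, or A = p1ᵀ) the quantity i_o involves log 0 and is undefined, and the claim can fail at i = 1; in that case ''sufficient iterations'' is taken to mean i ≥ 2. *)

(* Defs.v *)
From HB Require Import structures.
From mathcomp Require Import all_boot all_order all_algebra.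
From mathcomp Require Import complex.
From mathcomp Require Import all_classical all_reals all_analysis.

Set Implicit Arguments.
Unset Strict Implicit.
Unset Printing Implicit Defensive.

Import Order.TTheory GRing.Theory Num.Theory.
Import numFieldNormedType.Exports.

Local Open Scope classical_set_scope.
Local Open Scope ring_scope.

(* Points of R^M are row vectors.  The library norm `|x| on matrices is the sup
   norm; the Euclidean (Frobenius) norm below is the one that is used.  Stacking
   N row vectors as the rows of a matrix, it is the norm of the stacked vector. *)
Definition enorm (R : realType) (m n : nat) (x : 'M[R]_(m, n)) : R :=
  Num.sqrt (\sum_i \sum_j x i j ^+ 2).

Definition cnorm (R : realType) (n : nat) (x : 'cV[R[i]]_n) : R :=
  Num.sqrt (\sum_i ComplexField.Normc.normc (x i 0) ^+ 2).

Definition spectral_norm (R : realType) (n : nat) (B : 'M[R[i]]_n) : R :=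
  sup [set cnorm (B *m x) | x in [set x | cnorm x <= 1]].

Section calculus.
Context (R : realType) (M : nat).
Implicit Types (f : 'rV[R]_M -> R) (x : 'rV[R]_M).

Definition grad f x : 'rV[R]_M := \row_j 'D_(delta_mx 0 j) f x.

Definition twice_differentiable f : Prop :=
  forall x, differentiable f x /\ differentiable (grad f) x.

Definition hessian f x : 'M[R]_M := 'J (grad f) x.

Definition lambda_min (H : 'M[R]_M) : R := inf [set a | eigenvalue H a].

End calculus.

Section network.
Context (R : realType) (N : nat).
Implicit Types (A : 'M[R]_N).

Definition combination_matrix (neighbor : rel 'I_N) A : Prop :=
  [/\ forall l k, 0 <= A l k,
      forall k, \sum_l A l k = 1
    & forall l k, ~~ neighbor l k -> A l k = 0].

Definition strongly_connected A : Prop :=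
  (forall l k, connect [rel a b | A a b != 0] l k) /\ (exists k, 0 < A k k).

Definition perron_vector A (p : 'cV[R]_N) : Prop :=
  [/\ A *m p = p, \sum_k p k 0 = 1 & forall k, 0 < p k 0].

(* Jordan matrix with the ones on the first lower sub-diagonal. *)
Definition is_jordan (n : nat) (Jo : 'M[R[i]]_n) : Prop :=
  (forall i j : 'I_n, i != j -> i != j.+1 :> nat -> Jo i j = 0) /\
  (forall i j : 'I_n, i = j.+1 :> nat ->
     Jo i j = 0 \/ (Jo i j = 1 /\ Jo i i = Jo j j)).

(* A = V diag(1, Jo) V^-1 over the complex numbers, with Jo a Jordan matrix: the
   eigenvalue one of A is split off and Jo carries lambda_2(A), ..., lambda_N(A). *)
Definition jordan_remainder A (Jo : 'M[R[i]]_N.-1) : Prop :=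
  is_jordan Jo /\
  exists (V : 'M[R[i]]_(N, 1 + N.-1)) (Vinv : 'M[R[i]]_(1 + N.-1, N)),
    [/\ V *m Vinv = 1%:M, Vinv *m V = 1%:M
      & map_mx (real_complex R) A = V *m block_mx 1%:M 0 0 Jo *m Vinv].

Definition jordan_eps (n : nat) (eps : R) (Jo : 'M[R[i]]_n) : 'M[R[i]]_n :=
  \matrix_(i, j) (if i == j then Jo i j else (real_complex R eps) * Jo i j).

Definition higher_order_than_mu4 (eta : R -> R) : Prop :=
  let F := at_right (0 : R) in eta =o_F (fun mu : R => mu ^+ 4).

(* rho is the norm of the transpose of the eps-Jordan matrix, and v the value of
   the o(mu^4) function.  If rho = 0 the quotient of logarithms is meaningless;
   the disagreement due to the initial iterates then vanishes from time 1 on, and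
   the step from time i - 1 to time i is considered for i >= 2. *)
Definition sufficient_iterations (rho v : R) (i : nat) : Prop :=
  if rho == 0 then (2 <= i)%N else ln v / ln rho <= i%:R.

End network.

Section probability.
Context (R : realType) (d : measure_display) (T : measurableType d).
Context (P : probability T R).
Implicit Types (F : set (set T)) (X Y : T -> R) (B : set T).

(* Y is a version of E[X | F], for a sub-sigma-algebra F given as a set of events. *)
Definition is_cond_exp F X Y : Prop :=
  [/\ P.-integrable setT (EFin \o X),
      P.-integrable setT (EFin \o Y),
      forall S : set R, measurable S -> F (Y @^-1` S)
    & forall B, F B -> (\int[P]_(t in B) (Y t)%:E = \int[P]_(t in B) (X t)%:E)%E].

Definition cond_exp_le F X (c : R) : Prop :=
  exists Y, is_cond_exp F X Y /\ {ae P, forall t, Y t <= c}.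

(* E[X | B], for an event B of nonzero probability. *)
Definition exp_given X B : \bar R :=
  ((\int[P]_(t in B) (X t)%:E) * ((fine (P B))^-1)%:E)%E.

End probability.

Section diffusion.
Context (R : realType) (M N : nat) (d : measure_display) (T : measurableType d).
Context (P : probability T R).

(* ghat i k x t is the random approximation, drawn at time i by agent k, of the
   gradient of J k at x, for the outcome t. *)
Fixpoint diffusion (A : 'M[R]_N) (ghat : nat -> 'I_N -> 'rV[R]_M -> T -> 'rV[R]_M)
    (w0 : 'I_N -> T -> 'rV[R]_M) (mu : R) (i : nat) : 'I_N -> T -> 'rV[R]_M :=
  if i is i'.+1 then
    let w := diffusion A ghat w0 mu i' in
    let phi l t := w l t - mu *: ghat i l (w l t) t in
    fun k t => \sum_l A l k *: phi l t
  else w0.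

Definition centroid (p : 'cV[R]_N) (w : 'I_N -> T -> 'rV[R]_M) (t : T) : 'rV[R]_M :=
  \sum_k p k 0 *: w k t.

(* The sigma-algebra generated by the iterates of all agents at times 0, ..., i. *)
Definition history (w : nat -> 'I_N -> T -> 'rV[R]_M) (i : nat) : set (set T) :=
  <<s [set B | exists j k m (S : set R),
         [/\ (j <= i)%N, measurable S & B = [set t | S (w j k t 0 m)]]] >>.

Definition noise (J : 'I_N -> 'rV[R]_M -> R)
    (ghat : nat -> 'I_N -> 'rV[R]_M -> T -> 'rV[R]_M)
    (w : nat -> 'I_N -> T -> 'rV[R]_M) (i : nat) (k : 'I_N) (t : T) : 'rV[R]_M :=
  ghat i k (w i.-1 k t) t - grad (J k) (w i.-1 k t).

Definition gradient_noise (J : 'I_N -> 'rV[R]_M -> R)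
    (ghat : nat -> 'I_N -> 'rV[R]_M -> T -> 'rV[R]_M)
    (w : nat -> 'I_N -> T -> 'rV[R]_M) (sigma : R) : Prop :=
  let s := noise J ghat w in
  forall i, (0 < i)%N ->
  [/\ forall k m, is_cond_exp P (history w i.-1) (fun t => s i k t 0 m) (cst 0),
      forall k, cond_exp_le P (history w i.-1)
                  (fun t => enorm (s i k t) ^+ 4) (sigma ^+ 4)
    & forall k l, k != l -> forall m n,
        is_cond_exp P (history w i.-1) (fun t => ((s i k t)^T *m s i l t) m n) (cst 0)].

(* A random initial iterate with finite fourth moment. *)
Definition initial_iterate (w0 : 'I_N -> T -> 'rV[R]_M) : Prop :=
  (forall k m, measurable_fun setT (fun t => w0 k t 0 m)) /\
  ('E_P[fun t => (enorm (\matrix_k w0 k t) ^+ 4)%R] < +oo)%E.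

End diffusion.

Section costs.
Context (R : realType) (M N : nat).
Implicit Types (J : 'I_N -> 'rV[R]_M -> R).

Definition lipschitz_gradients J (delta : R) : Prop :=
  forall k x y, enorm (grad (J k) x - grad (J k) y) <= delta * enorm (x - y).

Definition bounded_disagreement J (G : R) : Prop :=
  forall k l x, enorm (grad (J k) x - grad (J l) x) <= G.

Definition aggregate (p : 'cV[R]_N) J (x : 'rV[R]_M) : R := \sum_k p k 0 * J k x.

Definition c1 (mu delta : R) : R := 2^-1 * (1 - 2 * mu * delta).

Definition c2 (delta sigma : R) : R := delta * sigma ^+ 2 / 2.

(* The parameter pi of the partition is written varpi. *)
Definition large_gradient (f : 'rV[R]_M -> R) (mu delta sigma varpi : R)
    : set 'rV[R]_M :=
  [set x | enorm (grad f x) ^+ 2 >=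
           mu * (c2 delta sigma / c1 mu delta) * (1 + varpi^-1)].

Definition second_order_stationary (f : 'rV[R]_M -> R)
    (mu delta sigma varpi tau : R) : set 'rV[R]_M :=
  ~` large_gradient f mu delta sigma varpi `&`
  [set x | lambda_min (hessian f x) > - tau].

End costs.

(* Main.v *)
(** Since A p = p, the network centroid w_c moves at each step by - mu (g + d + s),
where g is the gradient of J at the centroid, s is the averaged noise and d is the
error made by evaluating the gradients at the agents.
The quadratic upper bound for functions with Lipschitz gradient and
-g . d <= (|g|^2 + |d|^2) / 2 give
  J(w_c,i) <= J(w_c,i-1) - mu/2 |g|^2 + mu/2 |d|^2 + delta mu^2/2 |s|^2 + h . s
with h known at time i - 1, so that h . s integrates to 0 over every event of the
past.  Given the past E|s|^2 <= sigma^2, which yields mu^2 c_2, and on the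
large-gradient set - mu/2 |g|^2 <= - mu^2 c_2 (1 + 1/pi).

It remains to see E|d|^2 = O(mu^2).  As |d| is at most a multiple of the distance
of the iterates to consensus, one measures this distance by |Q W|, where W stacks
the iterates and Q is built from the generalized eigenvectors of A other than p,
rescaled by powers of eps: then |Q A^T W| <= rho |Q W| with rho = |J_eps^T| < 1,
and the increments have size mu because the gradients disagree by at most G up to
the disagreement itself.  Hence E|Q W_i|^2 <= rho^i E|Q W_0|^2 + O(mu^2), and
i >= i_o makes rho^i of order o(mu^4). *)

Require Import Defs.
From HB Require Import structures.
From mathcomp Require Import all_boot all_order all_algebra.
From mathcomp Require Import complex ring lra.
From mathcomp Require Import all_classical all_reals all_analysis.
From mathcomp Require Import measurable_realfun.
Set Implicit Arguments.
Unset Strict Implicit.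
Unset Printing Implicit Defensive.

Import Order.TTheory GRing.Theory Num.Theory.
Import numFieldNormedType.Exports.
Import HBNNSimple.
Local Open Scope classical_set_scope.
Local Open Scope ring_scope.

(** * Euclidean norm of matrices *)

(** Lagrange's identity: the right side exceeds the left by half the sum over i, j of (a_i b_j - a_j
    b_i)^2. *)
Lemma cauchy_schwarz (R : realType) (I : finType) (a b : I -> R) :
  (\sum_i a i * b i) ^+ 2 <= (\sum_i a i ^+ 2) * (\sum_i b i ^+ 2).
Proof.
have : 0 <= \sum_i \sum_j (a i * b j - a j * b i) ^+ 2.
  by apply: sumr_ge0 => i _; apply: sumr_ge0 => j _; exact: sqr_ge0.
have -> : \sum_i \sum_j (a i * b j - a j * b i) ^+ 2 =
  2 * ((\sum_i a i ^+ 2) * (\sum_i b i ^+ 2) - (\sum_i a i * b i) ^+ 2).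
  rewrite mulrBr [(\sum_i a i * b i) ^+ 2]expr2 !mulr_suml.
  transitivity (\sum_i \sum_j ((a i ^+ 2 * b j ^+ 2 + a j ^+ 2 * b i ^+ 2)
      - 2 * (a i * b i * (a j * b j)))).
    by apply: eq_bigr => i _; apply: eq_bigr => j _; ring.
  under eq_bigr do rewrite sumrB big_split.
  rewrite sumrB big_split /= [X in _ + X - _]exchange_big /=.
  rewrite mulr_natl mulr2n; congr (_ + _ - _).
  - by apply: eq_bigr => i _; rewrite mulr_sumr.
  - by apply: eq_bigr => i _; rewrite mulr_sumr.
  - by rewrite mulr_sumr; apply: eq_bigr => i _; rewrite !mulr_sumr.
by rewrite pmulr_rge0// subr_ge0.
Qed.

Section enorm.
Context (R : realType).

Lemma enorm_ge0 m n (x : 'M[R]_(m, n)) : 0 <= enorm x.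
Proof. exact: sqrtr_ge0. Qed.

Lemma enorm_sq m n (x : 'M[R]_(m, n)) : enorm x ^+ 2 = \sum_i \sum_j x i j ^+ 2.
Proof.
rewrite sqr_sqrtr//.
by apply: sumr_ge0 => i _; apply: sumr_ge0 => j _; exact: sqr_ge0.
Qed.

Lemma enorm_sq_rV n (x : 'rV[R]_n) : enorm x ^+ 2 = \sum_j x 0 j ^+ 2.
Proof. by rewrite enorm_sq big_ord1. Qed.

Lemma enorm_sq_cV n (x : 'cV[R]_n) : enorm x ^+ 2 = \sum_j x j 0 ^+ 2.
Proof. by rewrite enorm_sq; apply: eq_bigr => i _; rewrite big_ord1. Qed.

Lemma le_sqr_ge0 (a b : R) : 0 <= b -> a ^+ 2 <= b ^+ 2 -> a <= b.
Proof.
move=> b0; rewrite -ler_sqrt ?sqr_ge0// !sqrtr_sqr (ger0_norm b0).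
exact: le_trans (ler_norm _).
Qed.

Lemma enorm_row_sq m n (x : 'M[R]_(m, n)) :
  enorm x ^+ 2 = \sum_i enorm (row i x) ^+ 2.
Proof.
rewrite enorm_sq; apply: eq_bigr => i _; rewrite enorm_sq_rV.
by apply: eq_bigr => j _; rewrite mxE.
Qed.

Lemma enorm_col_sq m n (x : 'M[R]_(m, n)) :
  enorm x ^+ 2 = \sum_j enorm (col j x) ^+ 2.
Proof.
rewrite enorm_sq exchange_big; apply: eq_bigr => i _; rewrite enorm_sq_cV.
by apply: eq_bigr => j _; rewrite mxE.
Qed.

Lemma enormZ m n (a : R) (x : 'M[R]_(m, n)) : enorm (a *: x) = `|a| * enorm x.
Proof.
rewrite /enorm -sqrtr_sqr -sqrtrM ?sqr_ge0//; congr Num.sqrt.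
rewrite mulr_sumr; apply: eq_bigr => i _; rewrite mulr_sumr.
by apply: eq_bigr => j _; rewrite mxE exprMn.
Qed.

Lemma enormN m n (x : 'M[R]_(m, n)) : enorm (- x) = enorm x.
Proof. by rewrite -scaleN1r enormZ normrN1 mul1r. Qed.

Lemma enorm0 m n : enorm (0 : 'M[R]_(m, n)) = 0.
Proof. by rewrite -(scale0r 0) enormZ normr0 mul0r. Qed.

Lemma enorm_eq0 m n (x : 'M[R]_(m, n)) : enorm x = 0 -> x = 0.
Proof.
move=> x0; have : enorm x ^+ 2 = 0 by rewrite x0 expr0n.
rewrite enorm_sq => /eqP; rewrite psumr_eq0; last first.
  by move=> i _; apply: sumr_ge0 => j _; exact: sqr_ge0.
move=> /allP xi; apply/matrixP => i j; rewrite mxE.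
have := xi i; rewrite mem_index_enum => /(_ isT) /=.
rewrite psumr_eq0; last by move=> k _; exact: sqr_ge0.
by move=> /allP/(_ j); rewrite mem_index_enum => /(_ isT) /=; rewrite sqrf_eq0 => /eqP.
Qed.

Definition dot n (x y : 'rV[R]_n) : R := \sum_j x 0 j * y 0 j.

Lemma dot_le n (x y : 'rV[R]_n) : dot x y <= enorm x * enorm y.
Proof.
apply: le_sqr_ge0; first by rewrite mulr_ge0 ?enorm_ge0.
by rewrite exprMn !enorm_sq_rV cauchy_schwarz.
Qed.

Lemma dotC n (x y : 'rV[R]_n) : dot x y = dot y x.
Proof. by apply: eq_bigr => j _; rewrite mulrC. Qed.

Lemma dotDr n (x y z : 'rV[R]_n) : dot x (y + z) = dot x y + dot x z.
Proof. by rewrite -big_split; apply: eq_bigr => j _; rewrite mxE mulrDr. Qed.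

Lemma dotZr n (x : 'rV[R]_n) a (y : 'rV[R]_n) : dot x (a *: y) = a * dot x y.
Proof. by rewrite mulr_sumr; apply: eq_bigr => j _; rewrite mxE mulrCA. Qed.

Lemma dotDl n (x y z : 'rV[R]_n) : dot (x + y) z = dot x z + dot y z.
Proof. by rewrite dotC dotDr !(dotC z). Qed.

Lemma dotZl n a (x y : 'rV[R]_n) : dot (a *: x) y = a * dot x y.
Proof. by rewrite dotC dotZr dotC. Qed.

Lemma enorm_sqD n (x y : 'rV[R]_n) :
  enorm (x + y) ^+ 2 = enorm x ^+ 2 + 2 * dot x y + enorm y ^+ 2.
Proof.
rewrite !enorm_sq_rV mulr_sumr -!big_split; apply: eq_bigr => j _.
by rewrite !mxE sqrrD mulr_natl.
Qed.

Lemma enormD m n (x y : 'M[R]_(m, n)) : enorm (x + y) <= enorm x + enorm y.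
Proof.
apply: le_sqr_ge0; first by rewrite addr_ge0 ?enorm_ge0.
have xy : \sum_i \sum_j x i j * y i j <= enorm x * enorm y.
  apply: le_sqr_ge0; first by rewrite mulr_ge0 ?enorm_ge0.
  rewrite exprMn !enorm_sq !pair_big /=.
  exact: (cauchy_schwarz (fun ij => x ij.1 ij.2) (fun ij => y ij.1 ij.2)).
have -> : enorm (x + y) ^+ 2 =
    enorm x ^+ 2 + 2 * (\sum_i \sum_j x i j * y i j) + enorm y ^+ 2.
  rewrite !enorm_sq mulr_sumr -!big_split; apply: eq_bigr => i _ /=.
  rewrite mulr_sumr -!big_split; apply: eq_bigr => j _.
  by rewrite !mxE sqrrD mulr_natl.
nra.
Qed.

Lemma enorm_sum m n (I : finType) (F : I -> 'M[R]_(m, n)) :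
  enorm (\sum_i F i) <= \sum_i enorm (F i).
Proof.
elim/big_ind2: _ => [|x a y b xa yb|//]; first by rewrite enorm0.
by rewrite (le_trans (enormD _ _))// lerD.
Qed.

Lemma enorm_mulmx m n p (x : 'M[R]_(m, n)) (y : 'M[R]_(n, p)) :
  enorm (x *m y) <= enorm x * enorm y.
Proof.
apply: le_sqr_ge0; first by rewrite mulr_ge0 ?enorm_ge0.
rewrite exprMn (enorm_sq (x *m y)) (enorm_row_sq x) (enorm_col_sq y) mulr_suml.
apply: ler_sum => i _; rewrite mulr_sumr; apply: ler_sum => j _.
rewrite mxE enorm_sq_rV enorm_sq_cV (le_trans (cauchy_schwarz _ _))//.
by apply: ler_pM => //; do ?[apply: sumr_ge0 => k _; exact: sqr_ge0];
  apply: ler_sum => k _; rewrite mxE.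
Qed.

Lemma enorm_row_le m n (x : 'M[R]_(m, n)) i : enorm (row i x) <= enorm x.
Proof.
apply: le_sqr_ge0; first exact: enorm_ge0.
rewrite (enorm_row_sq x) (bigD1 i)//= lerDl.
by apply: sumr_ge0 => j _; exact: sqr_ge0.
Qed.

(** Triangle inequality over the splitting of [x] into its rows. The crude factor [m], in place of
    its square root, only enters constants independent of the step-size. *)
Lemma enorm_le_rows m n (x : 'M[R]_(m, n)) (c : R) : 0 <= c ->
  (forall i, enorm (row i x) <= c) -> enorm x <= m%:R * c.
Proof.
move=> c0 xc.
have -> : x = \sum_i delta_mx i 0 *m row i x.
  rewrite {1}[x]matrix_sum_delta; apply/matrixP => i j.
  rewrite !summxE (bigD1 i)//= [RHS](bigD1 i)//=; congr (_ + _).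
    rewrite summxE (bigD1 j)//= big1 ?addr0.
      by rewrite !mxE big_ord1 !mxE !eqxx/= mulr1 mul1r.
    by move=> k kj; rewrite !mxE eqxx eq_sym (negbTE kj) mulr0.
  rewrite !big1// => k ki.
    by rewrite !mxE big_ord1 !mxE eq_sym (negbTE ki)/= mul0r.
  by rewrite summxE big1// => l _; rewrite !mxE eq_sym (negbTE ki) mulr0.
rewrite (le_trans (enorm_sum _))// -[m in leRHS]card_ord mulr_natl -sumr_const.
apply: ler_sum => i _; rewrite (le_trans (enorm_mulmx _ _))//.
suff -> : enorm (delta_mx i 0 : 'M[R]_(m, 1)) = 1 by rewrite mul1r.
rewrite /enorm (bigD1 i)//= big_ord1 mxE !eqxx expr1n big1 ?addr0 ?sqrtr1//.
by move=> k ki; rewrite big_ord1 mxE (negbTE ki) expr0n.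
Qed.

End enorm.

(** * Contraction of the disagreement *)

Section realification.
Context (R : realType).
Local Notation C := R[i].
Local Notation toC := (map_mx (real_complex R)).

Definition re_mx m n (x : 'M[C]_(m, n)) : 'M[R]_(m, n) := map_mx (@complex.Re R) x.
Definition im_mx m n (x : 'M[C]_(m, n)) : 'M[R]_(m, n) := map_mx (@complex.Im R) x.

(** Complex vectors are identified with real ones of twice the length; columns keep their norms, so
    that estimates for [enorm] apply to [cnorm]. *)
Definition stack m n (x : 'M[C]_(m, n)) : 'M[R]_(m + m, n) :=
  col_mx (re_mx x) (im_mx x).

Lemma Re_sum (I : finType) (F : I -> C) :
  complex.Re (\sum_i F i) = \sum_i complex.Re (F i).
Proof. by apply: (big_morph (@complex.Re R)) => // -[a b] [c d]. Qed.

Lemma Im_sum (I : finType) (F : I -> C) :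
  complex.Im (\sum_i F i) = \sum_i complex.Im (F i).
Proof. by apply: (big_morph (@complex.Im R)) => // -[a b] [c d]. Qed.

Lemma re_mulmx m n p (x : 'M[C]_(m, n)) (y : 'M[C]_(n, p)) :
  re_mx (x *m y) = re_mx x *m re_mx y - im_mx x *m im_mx y.
Proof.
apply/matrixP => i j; rewrite !mxE Re_sum -sumrB; apply: eq_bigr => k _.
by rewrite !mxE; case: (x i k) => a b; case: (y k j) => c d.
Qed.

Lemma im_mulmx m n p (x : 'M[C]_(m, n)) (y : 'M[C]_(n, p)) :
  im_mx (x *m y) = im_mx x *m re_mx y + re_mx x *m im_mx y.
Proof.
apply/matrixP => i j; rewrite !mxE Im_sum -big_split; apply: eq_bigr => k _.
by rewrite !mxE; case: (x i k) => a b; case: (y k j) => c d /=; rewrite addrC.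
Qed.

Lemma re_toC m n (x : 'M[R]_(m, n)) : re_mx (toC x) = x.
Proof. by apply/matrixP => i j; rewrite !mxE. Qed.

Lemma im_toC m n (x : 'M[R]_(m, n)) : im_mx (toC x) = 0.
Proof. by apply/matrixP => i j; rewrite !mxE. Qed.

(** The real matrix of left multiplication by [x] under the identification [stack]. *)
Definition realify m n (x : 'M[C]_(m, n)) : 'M[R]_(m + m, n + n) :=
  block_mx (re_mx x) (- im_mx x) (im_mx x) (re_mx x).

Lemma stack_mulmx m n p (x : 'M[C]_(m, n)) (y : 'M[C]_(n, p)) :
  stack (x *m y) = realify x *m stack y.
Proof. by rewrite /stack /realify mul_block_col re_mulmx im_mulmx mulNmx. Qed.

Lemma stack_mulmx_toC m n p (x : 'M[C]_(m, n)) (y : 'M[R]_(n, p)) :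
  stack (x *m toC y) = stack x *m y.
Proof.
by rewrite /stack re_mulmx im_mulmx re_toC im_toC !mulmx0 subr0 addr0 mul_col_mx.
Qed.

Lemma cnormE n (x : 'cV[C]_n) : cnorm x = enorm (stack x).
Proof.
rewrite /cnorm /enorm; congr Num.sqrt.
under [RHS]eq_bigr do rewrite big_ord1.
rewrite big_split_ord /= -big_split; apply: eq_bigr => i _.
rewrite col_mxEu col_mxEd !mxE /=; case: (x i 0) => a b /=.
by rewrite sqr_sqrtr// addr_ge0 ?sqr_ge0.
Qed.

Lemma stack_eq0 m n (x : 'M[C]_(m, n)) : stack x = 0 -> x = 0.
Proof.
move=> x0; have /eqP := x0; rewrite col_mx_eq0 => /andP[/eqP re0 /eqP im0].
apply/matrixP => i j.
move/matrixP: re0 => /(_ i j); move/matrixP: im0 => /(_ i j); rewrite !mxE.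
by case: (x i j) => a b /= -> ->.
Qed.

Lemma stack0 m n : stack (0 : 'M[C]_(m, n)) = 0.
Proof.
rewrite -[RHS]col_mx0; congr col_mx; by apply/matrixP => i j; rewrite !mxE.
Qed.

(** A [sup] is an upper bound only for a bounded set; here the Frobenius norm of [realify B] is a
    bound. *)
Lemma spectral_norm_ub n (B : 'M[C]_n) :
  has_ubound [set cnorm (B *m x) | x in [set x : 'cV_n | cnorm x <= 1]].
Proof.
exists (enorm (realify B)) => _ [x /= x1 <-]; rewrite cnormE stack_mulmx.
rewrite (le_trans (enorm_mulmx _ _))// -[leRHS]mulr1 ler_wpM2l ?enorm_ge0//.
by rewrite -cnormE.
Qed.

Lemma spectral_norm_ge0 n (B : 'M[C]_n) : 0 <= spectral_norm B.
Proof.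
rewrite /spectral_norm; apply: ub_le_sup; first exact: spectral_norm_ub.
exists 0 => /=.
  by rewrite cnormE stack0 enorm0.
by rewrite mulmx0 cnormE stack0 enorm0.
Qed.

Lemma spectral_norm_le n (B : 'M[C]_n) (x : 'cV[C]_n) :
  cnorm (B *m x) <= spectral_norm B * cnorm x.
Proof.
have [x0|x0] := eqVneq (cnorm x) 0.
  rewrite x0 mulr0 cnormE stack_mulmx.
  by rewrite (enorm_eq0 (etrans (esym (cnormE x)) x0)) mulmx0 enorm0.
have xp : 0 < cnorm x by rewrite lt0r x0 cnormE enorm_ge0.
(* Normalising by right multiplication with a real 1 x 1 matrix keeps to operations that commute
   with [stack]. *)
pose y := x *m toC (cnorm x)^-1%:M.
have cy p (z : 'M[C]_(p, 1)) : stack (z *m toC (cnorm x)^-1%:M) =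
    (cnorm x)^-1 *: stack z by rewrite stack_mulmx_toC mul_mx_scalar.
have cnz p (z : 'cV[C]_p) : cnorm (z *m toC (cnorm x)^-1%:M) = (cnorm x)^-1 * cnorm z.
  by rewrite cnormE cy enormZ ger0_norm ?invr_ge0 ?ltW// -cnormE.
rewrite -ler_pdivrMr// mulrC -cnz -mulmxA.
rewrite /spectral_norm; apply: ub_le_sup; first exact: spectral_norm_ub.
exists y => //=.
by rewrite /y cnz mulVf.
Qed.

Lemma fixed_point_contraction n (B : 'M[C]_n) m (x : 'M[C]_(n, m)) :
  spectral_norm B < 1 -> B *m x = x -> x = 0.
Proof.
move=> B1 Bx; apply/matrixP => i j; rewrite mxE.
have : cnorm (col j x) <= spectral_norm B * cnorm (col j x).
  by rewrite -{1}Bx colE -mulmxA -colE spectral_norm_le.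
rewrite cnormE => h.
have : enorm (stack (col j x)) = 0.
  by have := enorm_ge0 (stack (col j x)); nra.
move=> /enorm_eq0/stack_eq0/matrixP/(_ i 0).
by rewrite !mxE.
Qed.

(** A nonzero fixed row makes 1 - B singular, hence also gives a nonzero fixed column; this avoids
    comparing the norms of [B] and of its transpose. *)
Lemma fixed_point_contraction_row n (B : 'M[C]_n) (y : 'rV[C]_n) :
  spectral_norm B < 1 -> y *m B = y -> y = 0.
Proof.
move=> B1 yB; apply/eqP; apply: contraT => y0.
have : \det (1%:M - B) = 0.
  by apply/eqP/det0P; exists y => //; rewrite mulmxBr mulmx1 yB subrr.
rewrite -det_tr => /eqP/det0P[v v0 vB].
suff : v^T = 0 by move=> /(congr1 trmx); rewrite trmxK trmx0 => /eqP; rewrite (negbTE v0).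
apply: (fixed_point_contraction B1); apply/eqP; rewrite eq_sym -subr_eq0; apply/eqP.
by rewrite -{1}(mul1mx v^T) -mulmxBl -[1%:M - B]trmxK -trmx_mul vB trmx0.
Qed.

End realification.

(** * Coordinates contracting towards consensus *)

Section consensus.
Context (R : realType) (N : nat).
Local Notation C := R[i].
Local Notation toC := (map_mx (real_complex R)).
Variables (A : 'M[R]_N) (p : 'cV[R]_N) (eps : R) (Jo : 'M[C]_N.-1).
Hypothesis A_stoch : forall k, \sum_l A l k = 1.
Hypothesis p_perron : perron_vector A p.
Hypothesis Jo_jordan : jordan_remainder A Jo.
Hypothesis eps_gt0 : 0 < eps.
Let K := (jordan_eps eps Jo)^T.
Hypothesis K_lt1 : spectral_norm K < 1.
Let one : 'cV[R]_N := const_mx 1.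

Lemma trmx_stoch : A^T *m one = one.
Proof.
apply/matrixP => k j; rewrite !mxE -(A_stoch k).
by apply: eq_bigr => l _; rewrite !mxE mulr1.
Qed.

(* In the coordinates given by the generalized eigenvectors of A, rescaled by the
   powers of eps, A^T acts as K on the complement of the consensus direction. *)
Lemma consensus_factorization : exists (B : 'M[C]_(N.-1, N)) (L : 'M[C]_(N, N.-1)),
  [/\ B *m toC A^T = K *m B, B *m toC one = 0
    & L *m B = toC (1%:M - one *m p^T)].
Proof.
have [Jtri [V [Vinv [VVi ViV AV]]]] := Jo_jordan.
have [Jdiag Jsub] := Jtri.
pose D : 'M[C]_N.-1 := diag_mx (\row_j (real_complex R (eps ^+ j))).
pose Di : 'M[C]_N.-1 := diag_mx (\row_j (real_complex R (eps ^- j))).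
have eX (j : nat) : real_complex R (eps ^+ j) * real_complex R (eps ^- j) = 1.
  by rewrite -rmorphM mulfV ?rmorph1// expf_neq0// gt_eqF.
have DDi : D *m Di = 1%:M.
  by rewrite mulmx_diag -diag_const_mx; congr diag_mx; apply/rowP => j; rewrite !mxE eX.
have DiD : Di *m D = 1%:M.
  rewrite mulmx_diag -diag_const_mx; congr diag_mx; apply/rowP => j.
  by rewrite !mxE mulrC eX.
(* Off the diagonal [Jo^T] lives only at (i, i+1), where eps^i eps = eps^(i+1): conjugation by the
   powers of eps turns the ones into eps. *)
have DK : D *m K = Jo^T *m D.
  apply/matrixP => i j; rewrite mul_diag_mx mul_mx_diag !mxE.
  have [ji|ji] := eqVneq j i; first by rewrite ji mulrC.
  have [jiS|jiS] := eqVneq (j : nat) i.+1; last by rewrite Jdiag// !mulr0 mul0r.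
  by rewrite mulrA -rmorphM -exprSr -jiS mulrC.
pose VR := rsubmx V; pose UR := (dsubmx Vinv)^T.
pose v0 := lsubmx V; pose u0 := (usubmx Vinv)^T.
have AVR : toC A *m VR = VR *m Jo.
  have : toC A *m V = V *m block_mx 1%:M 0 0 Jo by rewrite AV -mulmxA ViV mulmx1.
  rewrite -{2}[V]hsubmxK mul_row_block !mulmx0 add0r addr0 mulmx1.
  by rewrite -{1}[V]hsubmxK mul_mx_row => /eq_row_mx[].
have Av0 : toC A *m v0 = v0.
  have : toC A *m V = V *m block_mx 1%:M 0 0 Jo by rewrite AV -mulmxA ViV mulmx1.
  rewrite -{2}[V]hsubmxK mul_row_block !mulmx0 add0r addr0 mulmx1.
  by rewrite -{1}[V]hsubmxK mul_mx_row => /eq_row_mx[].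
have URA : toC A^T *m UR = UR *m Jo^T.
  have : Vinv *m toC A = block_mx 1%:M 0 0 Jo *m Vinv.
    by rewrite AV !mulmxA ViV mul1mx.
  rewrite -{2}[Vinv]vsubmxK mul_block_col !mul0mx add0r addr0 mul1mx.
  rewrite -{1}[Vinv]vsubmxK mul_col_mx => /eq_col_mx[_ /(congr1 trmx)].
  by rewrite !trmx_mul map_trmx.
have split1 : u0 *m v0^T + UR *m VR^T = 1%:M.
  have := VVi; rewrite -[V]hsubmxK -[Vinv]vsubmxK mul_row_col => /(congr1 trmx).
  by rewrite linearD /= !trmx_mul trmx1.
pose B := Di *m VR^T; pose L := UR *m D.
have LB : L *m B = UR *m VR^T by rewrite mulmxA -(mulmxA UR) DDi mulmx1.
have BA : B *m toC A^T = K *m B.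
  rewrite -mulmxA -map_trmx -trmx_mul AVR trmx_mul /B !mulmxA; congr (_ *m _).
  by rewrite -[LHS]mulmx1 -DDi -mulmxA (mulmxA Jo^T) -DK !mulmxA DiD mul1mx.
have AL : toC A^T *m L = L *m K.
  by rewrite /L mulmxA URA -!mulmxA DK.
(* Since A^T fixes the all-ones vector, its image under [B] is a fixed point of [K]. *)
have B1 : B *m toC one = 0.
  apply: (fixed_point_contraction K_lt1).
  by rewrite mulmxA -BA -mulmxA -map_mxM trmx_stoch.
exists B, L; split => //.
have [Ap p1 _] := p_perron.
have p1E : p^T *m one = 1%:M.
  apply/matrixP => i j; rewrite !ord1 !mxE eqxx -p1.
  by apply: eq_bigr => k _; rewrite !mxE mulr1.
(* It remains to see that [v0], the eigenvector of A for 1 supplied by the Jordan form, is a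
   multiple of [p]. The row [y] is the defect; it is fixed by right multiplication by A^T, hence
   [y *m L] by that of [K]. *)
pose y := v0^T - v0^T *m toC (one *m p^T).
have y1 : y *m toC one = 0.
  by rewrite mulmxBl -(mulmxA v0^T) -map_mxM -mulmxA p1E mulmx1 subrr.
have yA : y *m toC A^T = y.
  rewrite mulmxBl -(mulmxA v0^T) -map_mxM -mulmxA -trmx_mul Ap.
  by rewrite -map_trmx -trmx_mul Av0.
have yL : y *m L = 0.
  by apply: (fixed_point_contraction_row K_lt1); rewrite -mulmxA -AL mulmxA yA.
have yE : y = y *m u0 *m v0^T.
  by rewrite -{1}[y]mulmx1 -split1 mulmxDr -LB (mulmxA y L B) (mulmxA y u0) yL mul0mx addr0.
have y0 : y = 0.
  (* [y] is a multiple of v0^T and vanishes on the all-ones vector. If the factor is not 0, then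
     v0^T vanishes there as well, and with [B1] the resolution of the identity [split1] makes the
     all-ones vector 0. *)
  have c0 : (y *m u0) *m (v0^T *m toC one) = 0 by rewrite mulmxA -yE.
  move: c0; rewrite [y *m u0]mx11_scalar mul_scalar_mx => /eqP.
  rewrite scaler_eq0 => /orP[/eqP c0|/eqP v1].
    by rewrite yE [y *m u0]mx11_scalar c0 mul_scalar_mx scale0r.
  have : toC one = 0.
    by rewrite -[LHS]mul1mx -split1 mulmxDl -mulmxA v1 mulmx0 add0r -LB -mulmxA B1 mulmx0.
  have [k _] : exists k : 'I_N, True.
    case: (pickP 'I_N) => [k _|h0]; first by exists k.
    by move: p1; rewrite big1 => [/eqP|k]; [rewrite eq_sym oner_eq0|have := h0 k].
  move=> /matrixP/(_ k 0); rewrite !mxE => /eqP.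
  by rewrite (fmorph_eq0 (real_complex R)) oner_eq0.
(* By [y0] the factor 1 - 1 p^T kills v0^T, and by [B1] it leaves [B] unchanged; so applied to the
   identity of [split1] it leaves exactly [L *m B]. *)
have -> : L *m B = (u0 *m v0^T + L *m B) *m toC (1%:M - one *m p^T).
  rewrite mulmxDl map_mxB map_mx1 -(mulmxA u0) [v0^T *m _]mulmxBr mulmx1 -/y y0.
  rewrite mulmx0 add0r mulmxBr mulmx1 map_mxM -(mulmxA L) [B *m _]mulmxA B1 mul0mx.
  by rewrite mulmx0 subr0.
by rewrite LB split1 mul1mx.
Qed.

(** [Q] stacks the real and imaginary parts of [B], so that the contraction factor stays the norm of
    [K], column by column. [S] forms the real part of [L *m B], which is real already. *)
Lemma consensus_contraction : exists n (Q : 'M[R]_(n, N)) (S : 'M[R]_(N, n)),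
  [/\ Q *m one = 0, S *m Q = 1%:M - one *m p^T
    & forall m (W : 'M[R]_(N, m)),
        enorm (Q *m (A^T *m W)) <= spectral_norm K * enorm (Q *m W)].
Proof.
have [B [L [BA B1 LB]]] := consensus_factorization.
exists _, (stack B), (row_mx (re_mx L) (- im_mx L)); split.
- by rewrite -stack_mulmx_toC B1 stack0.
- by rewrite mul_row_col mulNmx -re_mulmx LB re_toC.
move=> m W; apply: le_sqr_ge0; first by rewrite mulr_ge0 ?spectral_norm_ge0 ?enorm_ge0.
rewrite exprMn !enorm_col_sq mulr_sumr; apply: ler_sum => j _.
rewrite -exprMn ler_pXn2r ?nnegrE ?mulr_ge0 ?spectral_norm_ge0 ?enorm_ge0//.
rewrite !colE -!mulmxA -!colE -!stack_mulmx_toC map_mxM [B *m _]mulmxA BA.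
by rewrite -!cnormE -mulmxA spectral_norm_le.
Qed.

End consensus.

(** * Descent lemma *)

Section descent.
Context (R : realType) (M : nat).
Implicit Types (f : 'rV[R]_M -> R) (x y v : 'rV[R]_M).

Lemma deriv_dot_grad f x v : differentiable f x -> 'D_v f x = dot (grad f x) v.
Proof.
move=> df; rewrite deriveE// {1}[v]row_sum_delta linear_sum /dot.
apply: eq_bigr => j _; rewrite linearZ /= !mxE mulrC; congr (_ * _).
by rewrite deriveE.
Qed.

Lemma is_derive_line f x v (t : R) : (forall z, differentiable f z) ->
  is_derive t 1 (fun s : R => f (x + s *: v)) (dot (grad f (x + t *: v)) v).
Proof.
move=> df.
have dfv : derivable f (x + t *: v) v by exact: diff_derivable.
have E : (fun h => h^-1 *:
    (((fun s : R => f (x + s *: v)) \o shift t) (h *: 1) - f (x + t *: v)))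
    = (fun h => h^-1 *: ((f \o shift (x + t *: v)) (h *: v) - f (x + t *: v))).
  apply/funext => h /=; congr (_ *: (f _ - _)).
  by rewrite [h%:A]mulr1 scalerDl addrCA.
split; first by rewrite /derivable E.
by rewrite /derive E -/(derive f _ _) deriv_dot_grad.
Qed.

Lemma descent_lemma f (delta : R) x y :
  (forall z, differentiable f z) ->
  (forall a b, enorm (grad f a - grad f b) <= delta * enorm (a - b)) ->
  f y <= f x + dot (grad f x) (y - x) + delta / 2 * enorm (y - x) ^+ 2.
Proof.
move=> df lip; set v := y - x; set g0 := dot (grad f x) v.
(* Subtracting the quadratic bound leaves a function with derivative at most 0 on [0, 1], because
   the gradient varies by at most delta t |v| along the segment; the mean value theorem replaces
   integration, and the claim is h 1 <= h 0. *)
pose h (s : R) := f (x + s *: v) - (s * g0 + delta / 2 * enorm v ^+ 2 * s ^+ 2).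
have dh (t : R) : is_derive t 1 h
    (dot (grad f (x + t *: v)) v - (g0 + delta * enorm v ^+ 2 * t)).
  have d1 := @is_derive_line f x v t df.
  apply: is_derive_eq.
  rewrite /GRing.scale/=; lra.
have hle : h 1 <= h 0.
  have [|c] := @MVT_segment R h _ 0 1 ler01 (fun t _ => dh t).
    apply: continuous_subspaceT => t.
    by apply: differentiable_continuous; apply/derivable1_diffP; exact: ex_derive.
  rewrite in_itv/= => /andP[c0 c1].
  rewrite subr0 mulr1 => hE; rewrite -subr_le0 hE.
  have -> : dot (grad f (x + c *: v)) v = g0 + dot (grad f (x + c *: v) - grad f x) v.
    by rewrite /g0 -dotDl addrCA subrr addr0.
  have := dot_le (grad f (x + c *: v) - grad f x) v.
  have := lip (x + c *: v) x; rewrite [x + _]addrC addrK enormZ ger0_norm//.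
  have := enorm_ge0 v; have := enorm_ge0 (grad f (c *: v + x) - grad f x).
  nra.
move: hle; rewrite /h scale1r scale0r addr0 [x + v]addrCA subrr addr0; lra.
Qed.

End descent.

(** * Measurability *)

Section eigenvalues.
Context (R : realType) (M : nat).
Implicit Types H : 'M[R]_M.

Lemma horner_char_poly H a : (char_poly H).[a] = \det (a%:M - H).
Proof.
rewrite /char_poly -horner_evalE -det_map_mx; congr (\det _); apply/matrixP => i j.
by rewrite !mxE /= /horner_eval hornerD hornerN hornerC hornerMn hornerX.
Qed.

Lemma eigenvalue_det H a : eigenvalue H a = (\det (a%:M - H) == 0).
Proof.
apply/eigenvalueP/det0P => -[v].
  by move=> vH v0; exists v => //; rewrite mulmxBr mul_mx_scalar vH subrr.
move=> v0 /eqP; rewrite mulmxBr mul_mx_scalar subr_eq0 => /eqP vH.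
by exists v.
Qed.

(** Bounds the real eigenvalues from below, so that the [inf] in [lambda_min] is a genuine infimum
    as soon as one exists. *)
Lemma eigenvalue_ge H a : eigenvalue H a -> - enorm H <= a.
Proof.
move=> /eigenvalueP[v vH v0].
have vp : 0 < enorm v.
  by rewrite lt0r enorm_ge0 andbT; apply: contraNneq v0 => /enorm_eq0 ->.
have := enorm_mulmx v H; rewrite vH enormZ mulrC ler_pM2l// => aH.
by have := ler_norm (- a); rewrite normrN; lra.
Qed.

(** Determinants are measurable in the entries, which is why they appear here. The infimum of the
    real eigenvalues is attained, as the roots of the characteristic polynomial form a closed
    set. *)
Lemma lambda_min_gt H tau : 0 < tau ->
  (- tau < lambda_min H) <-> (forall a, a <= - tau -> \det (a%:M - H) != 0).
Proof.
move=> tau0; have lbE : has_lbound [set a | eigenvalue H a].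
  by exists (- enorm H) => a /= /eigenvalue_ge.
split=> [tl a atau|h].
  rewrite -eigenvalue_det; apply: contraL tl => ea; rewrite -leNgt.
  by rewrite (le_trans _ atau)// /lambda_min; apply: ge_inf.
(* Without real eigenvalues [lambda_min] has the default value 0 of [inf set0], which exceeds -
   tau. *)
have [E0|/set0P E0] := eqVneq [set a | eigenvalue H a] set0.
  by rewrite /lambda_min E0 inf0 oppr_lt0.
rewrite ltNge; apply/negP => itau; set m := lambda_min H in itau.
have qm : (char_poly H).[m] != 0 by rewrite horner_char_poly h.
(* By continuity a non-root [m] has a neighbourhood free of roots, yet eigenvalues come arbitrarily
   close to their infimum. *)
have : \forall x \near m, (char_poly H).[x] != 0.
  have cq : (fun x => (char_poly H).[x]) x @[x --> m] --> (char_poly H).[m].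
    exact: continuous_horner.
  exact: (cvgr_neq0 _ cq qm).
move=> /nbhs_ballP[e /= e0 eq0].
have [a /= ea ma] := inf_adherent e0 (conj E0 lbE).
have mea : m <= a by apply: ge_inf.
have /eq0/eqP : ball m e a by rewrite /ball/= ler0_norm; rewrite /m /lambda_min; lra.
by apply; apply/eqP; rewrite horner_char_poly -eigenvalue_det.
Qed.

End eigenvalues.

(** Turns a quantifier over the reals into countable ones, for measurability. Backwards, |q| attains
    its minimum on the segment, and approximate roots force this minimum to be 0. *)
Lemma poly_root_in_segment (R : realType) (q : {poly R}) (l u : R) : l < u ->
  (exists2 a, l <= a <= u & q.[a] = 0) <->
  (forall k : nat, exists r : rat,
     (l <= ratr r <= u) && (`|q.[ratr r]| < k.+1%:R^-1)).
Proof.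
move=> lu; split=> [[a /andP[la au] qa] k|h].
  have k0 : 0 < k.+1%:R^-1 :> R by rewrite invr_gt0 ltr0n.
  have /cvgrPdist_lt/(_ _ k0)/nbhs_ballP[e /= e0 he] := @continuous_horner _ q a.
  (* As l < u, the open interval is nonempty even if [a] is an endpoint. *)
  have [|r] := @rat_in_itvoo R (Num.max l (a - e)) (Num.min u (a + e)).
    by rewrite lt_min !gt_max; apply/andP; split; apply/andP; split; lra.
  rewrite in_itv/= gt_max lt_min => /andP[/andP[lr aer] /andP[ru rae]].
  exists r; rewrite !ltW//=.
  have /he : ball a e (ratr r) by rewrite /ball/= ltr_norml; apply/andP; split; lra.
  by rewrite /= qa sub0r normrN.
have qc : continuous (fun x => `|q.[x]|).
  by move=> x; apply: cvg_norm; exact: continuous_horner.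
have [c] := @EVT_min _ _ _ _ (ltW lu) (continuous_subspaceT qc).
rewrite in_itv/= => clu cmin; exists c => //; apply/eqP; apply: contraT => qc0.
have nq0 : 0 < `|q.[c]| by rewrite normr_gt0.
have [k hk] : exists k : nat, k.+1%:R^-1 < `|q.[c]|.
  exists (Num.truncn (`|q.[c]|^-1)).
  by rewrite invf_plt ?posrE ?ltr0n// truncnS_gt.
have [r /andP[rlu /lt_trans/(_ hk)]] := h k.
by rewrite ltNge cmin// in_itv.
Qed.

Lemma continuous_grad (R : realType) (M : nat) (f : 'rV[R]_M -> R) j :
  twice_differentiable f -> continuous (fun x => grad f x 0 j).
Proof.
move=> df x; have cgx := differentiable_continuous (df x).2.
apply: (@continuous_comp _ _ _ (grad f) (fun y : 'rV[R]_M => y 0 j)) => //.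
exact: coord_continuous.
Qed.

(** * Measurability of functions of a random vector *)

Section measurability_rV.
Context (R : realType) (d : measure_display) (T : measurableType d) (M : nat).
Variable X : T -> 'rV[R]_M.
Hypothesis mX : forall j, measurable_fun setT (fun t => X t 0 j).

(** An open set is the union of the countably many boxes of rational centre and radius that it
    contains. *)
Lemma measurable_preimage_open (U : set 'rV[R]_M) : open U -> measurable (X @^-1` U).
Proof.
move=> oU.
pose box (i : 'rV[rat]_M * rat) : set 'rV[R]_M :=
  [set y | forall j, y 0 j \in `]ratr (i.1 0 j) - ratr i.2, ratr (i.1 0 j) + ratr i.2[].
pose F i := if `[< box i `<=` U >] then X @^-1` box i else set0.
rewrite (_ : X @^-1` U = \bigcup_i F i).
  apply: countable_bigcupT_measurable => [|i]; first exact: countableP.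
  rewrite /F; case: ifP => // _.
  rewrite (_ : X @^-1` box i = \bigcap_(j in [set: 'I_M])
      (fun t => X t 0 j) @^-1` [set` `]ratr (i.1 0 j) - ratr i.2, ratr (i.1 0 j) + ratr i.2[]).
    apply: fin_bigcap_measurable => // j _.
    by rewrite -[X in measurable X]setTI; exact: mX.
  by apply/seteqP; split => t /= h j; [move=> _; exact: h | exact: h j I].
apply/seteqP; split => t /=; last first.
  by move=> [i _]; rewrite /F; case: ifP => // /asboolP iU /iU.
move=> Ut; have /nbhs_ballP[e /= e0 eU] : nbhs (X t) U by exact: open_nbhs_nbhs.
(* With radius below e / 2, every point of a box holding [X t] is at sup-distance less than 2 r0 < e
   from it. *)
have [r0] := @rat_in_itvoo R 0 (e / 2) (divr_gt0 e0 (ltr0Sn _ _)).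
rewrite in_itv/= => /andP[r00 r0e].
have /choice[q hq] : forall j, exists q : rat,
    ratr q \in `]X t 0 j - ratr r0, X t 0 j + ratr r0[.
  by move=> j; apply: rat_in_itvoo; lra.
have bt : box (\row_j q j, r0) (X t).
  move=> j /=; rewrite mxE in_itv/=; have := hq j; rewrite in_itv/= => /andP[h1 h2].
  by apply/andP; split; lra.
exists (\row_j q j, r0) => //; rewrite /F; case: ifPn => // /asboolP[] y yb.
apply: eU; split => // i j; rewrite ord1.
have := yb j; have := bt j; rewrite /= mxE !in_itv/= => /andP[h1 h2] /andP[h3 h4].
by rewrite /ball/= ltr_norml; apply/andP; split; lra.
Qed.

Lemma measurable_comp_continuous (f : 'rV[R]_M -> R) :
  continuous f -> measurable_fun setT (f \o X).
Proof.
move=> /continuousP cf.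
apply: (measurability _ (RGenOpens.measurableE R)) => _ [_ [a [b ->]] <-].
rewrite setTI comp_preimage; apply: measurable_preimage_open; apply: cf.
exact: interval_open.
Qed.

(** Second derivatives may be discontinuous, but they are pointwise limits of difference quotients
    of the gradient, which is continuous because it is differentiable. *)
Lemma measurable_hessian (f : 'rV[R]_M -> R) : twice_differentiable f ->
  forall i j, measurable_fun setT (fun t => hessian f (X t) i j).
Proof.
move=> df i j.
pose e : 'rV[R]_M := delta_mx 0 i.
pose h n t : R := (harmonic n)^-1 * (grad f (harmonic n *: e + X t) 0 j - grad f (X t) 0 j).
have cg := @continuous_grad _ _ f j df.
apply: (@measurable_fun_cvg _ _ _ _ h) => [n|t _].
  apply: measurable_funM => //; apply: measurable_funB.
    rewrite (_ : (fun t => _) = (fun x => grad f (harmonic n *: e + x) 0 j) \o X)//.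
    apply: measurable_comp_continuous => x.
    apply: (@continuous_comp _ _ _ (fun x => harmonic n *: e + x) (fun x => grad f x 0 j)).
      exact: continuousD (@cst_continuous _ _ (harmonic n *: e) x) (@cvg_id _ (nbhs x)).
    exact: cg.
  exact: (measurable_comp_continuous cg).
have dg : derivable (grad f) (X t) e by exact: diff_derivable (df (X t)).2.
have -> : hessian f (X t) i j = ('D_e (grad f) (X t)) 0 j.
  by rewrite (@deriveEjacobian _ _ _ (grad f) (X t) e (df (X t)).2) /e -rowE [RHS]mxE.
have h0 : @harmonic R @ \oo --> (0 : R)^'.
  move=> B; rewrite /dnbhs /within /= => HB.
  have H : \forall n \near \oo, harmonic n != 0 :> R -> B (harmonic n) := @cvg_harmonic R _ HB.
  change (\forall n \near \oo, B (harmonic n)).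
  by apply: filterS H => n; apply; rewrite gt_eqF// harmonic_gt0.
have /= c1 := cvg_comp _ _ h0 dg.
have c2 := @coord_continuous R 1 M 0 j ('D_e (grad f) (X t)).
have := cvg_comp _ _ c1 c2.
apply: cvg_trans; apply: near_eq_cvg; near=> n.
by rewrite /h /= !mxE.
Unshelve. all: by end_near. Qed.

Lemma measurable_det (H : T -> 'M[R]_M) :
  (forall i j, measurable_fun setT (fun t => H t i j)) ->
  measurable_fun setT (fun t => \det (H t)).
Proof.
move=> mH; apply: measurable_sum => s; apply: measurable_funM => //.
by apply: measurable_prod => i _; exact: mH.
Qed.

Lemma measurable_lambda_min (H : T -> 'M[R]_M) tau : 0 < tau ->
  (forall i j, measurable_fun setT (fun t => H t i j)) ->
  measurable [set t | - tau < lambda_min (H t)].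
Proof.
move=> tau0 mH.
(* The complement is the existence of an eigenvalue in some segment [- tau - (n+1), - tau],
   expressed by rational approximate roots; n + 1 instead of n keeps the segment nondegenerate. *)
pose S n k (r : rat) := if - tau - n.+1%:R <= ratr r <= - tau then
  (fun t => `|\det ((ratr r)%:M - H t)|) @^-1` `]-oo, k.+1%:R^-1[ else set0.
have lu n : - tau - n.+1%:R < - tau by rewrite ltrBlDr ltrDl ltr0n.
rewrite (_ : [set t | _] = ~` \bigcup_n \bigcap_k \bigcup_r S n k r).
  apply: measurableC; apply: bigcupT_measurable => n.
  apply: bigcapT_measurable => k; apply: bigcupT_measurable_rat => r.
  rewrite /S; case: ifP => // _; rewrite -[X in measurable X]setTI.
  suff : measurable_fun setT (fun t => `|\det ((ratr r)%:M - H t)|) by apply.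
  apply: measurableT_comp => //; apply: measurable_det => i j.
  under eq_fun do rewrite !mxE.
  by apply: measurable_funB.
apply/seteqP; split => t /=.
  move=> /(lambda_min_gt _ tau0) h [n _ hn].
  have [|a /andP[_ atau] /eqP] := (poly_root_in_segment (char_poly (H t)) (lu n)).2.
  - move=> k; have [r _] := hn k I; rewrite /S; case: ifP => // rr /=.
    by rewrite in_itv/= => rk; exists r; rewrite horner_char_poly rr.
  - by rewrite horner_char_poly (negbTE (h _ atau)).
move=> hn; apply/(lambda_min_gt _ tau0) => a atau; apply/eqP => da; apply: hn.
exists (Num.truncn (- tau - a)) => // k _.
have [|r /andP[rr rk]] :=
  (poly_root_in_segment (char_poly (H t)) (lu (Num.truncn (- tau - a)))).1 _ k.
- exists a; last by rewrite horner_char_poly.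
  by rewrite atau andbT; have := truncnS_gt (- tau - a); lra.
by exists r => //; rewrite /S rr/= in_itv/= -horner_char_poly.
Qed.

End measurability_rV.

(** * Square-integrable variables and conditioning *)

Section square_integrable.
Context (R : realType) (d : measure_display) (T : measurableType d).
Context (P : probability T R).
Implicit Types (X Y : T -> R) (B : set T).

Definition rint X : Prop := P.-integrable setT (EFin \o X).

(** Measurability of [X] is a clause of its own, since that of the square does not imply it. *)
Definition sqint X : Prop :=
  measurable_fun setT X /\ rint (fun t => X t ^+ 2).

Lemma rint_measurable X : rint X -> measurable_fun setT X.
Proof. by move=> /measurable_int/measurable_EFinP. Qed.

Lemma rint_le X Y : measurable_fun setT X -> rint Y ->
  (forall t, `|X t| <= Y t) -> rint X.
Proof.
move=> mX iY XY; apply: le_integrable iY => //; first exact/measurable_EFinP.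
by move=> t _; rewrite lee_fin (le_trans (XY t))// ler_norm.
Qed.

Lemma rint_cst (c : R) : rint (fun=> c).
Proof. exact: (finite_measure_integrable_cst P c measurableT). Qed.

Lemma rintD X Y : rint X -> rint Y -> rint (fun t => X t + Y t).
Proof. by move=> iX iY; exact: (integrableD measurableT iX iY). Qed.

Lemma rintZ (c : R) X : rint X -> rint (fun t => c * X t).
Proof. by move=> iX; exact: (integrableZl measurableT c iX). Qed.

Lemma rint_sum (I : finType) (X : I -> T -> R) :
  (forall i, rint (X i)) -> rint (fun t => \sum_i X i t).
Proof.
move=> iX; rewrite /rint (_ : EFin \o _ = (fun t => (\sum_i (X i t)%:E)%E)).
  by apply: integrable_sum => // i _; exact: iX.
by apply/funext => t /=; rewrite sumEFin.
Qed.

Lemma rintS X B : measurable B -> rint X -> P.-integrable B (EFin \o X).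
Proof. by move=> mB iX; exact: integrableS iX. Qed.

Lemma sqint_mul X Y : sqint X -> sqint Y -> rint (fun t => X t * Y t).
Proof.
move=> [mX iX] [mY iY]; apply: rint_le (rintD iX iY) _.
  exact: measurable_funM.
move=> t; rewrite ler_norml; nra.
Qed.

Lemma sqint_le X Y : measurable_fun setT X -> rint Y ->
  (forall t, X t ^+ 2 <= Y t) -> sqint X.
Proof.
move=> mX iY XY; split => //; apply: rint_le iY _.
  exact: measurable_funX.
by move=> t; rewrite ger0_norm ?sqr_ge0.
Qed.

Lemma sqint_rint X : sqint X -> rint X.
Proof.
move=> [mX iX]; apply: (@rint_le X (fun t => 1 + X t ^+ 2)) => //.
  by apply: rintD => //; exact: rint_cst.
by move=> t; rewrite ler_norml; nra.
Qed.

Lemma sqint_cst (c : R) : sqint (fun=> c).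
Proof. by split; [exact: measurable_cst|exact: rint_cst]. Qed.

Lemma sqintD X Y : sqint X -> sqint Y -> sqint (fun t => X t + Y t).
Proof.
move=> [mX iX] [mY iY].
apply: (sqint_le (Y := fun t => 2 * X t ^+ 2 + 2 * Y t ^+ 2)).
- exact: measurable_funD.
- by apply: rintD; exact: rintZ.
- by move=> t; have := sqr_ge0 (X t - Y t); nra.
Qed.

Lemma sqintZ (c : R) X : sqint X -> sqint (fun t => c * X t).
Proof.
move=> [mX iX]; apply: (sqint_le (Y := fun t => c ^+ 2 * X t ^+ 2)).
- exact: measurable_funM.
- exact: rintZ.
- by move=> t; rewrite exprMn.
Qed.

Lemma sqint_sum (I : finType) (X : I -> T -> R) :
  (forall i, sqint (X i)) -> sqint (fun t => \sum_i X i t).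
Proof.
move=> iX; elim: (index_enum I) => [|i r IH].
  by under eq_fun do rewrite big_nil; exact: sqint_cst.
by under eq_fun do rewrite big_cons; exact: sqintD.
Qed.

Section expectation.
Variable B : set T.
Hypothesis mB : measurable B.

Lemma RintD X Y : rint X -> rint Y ->
  \int[P]_(t in B) (X t + Y t) = \int[P]_(t in B) X t + \int[P]_(t in B) Y t.
Proof. by move=> iX iY; rewrite RintegralD//; exact: rintS. Qed.

Lemma RintZ (c : R) X : rint X ->
  \int[P]_(t in B) (c * X t) = c * \int[P]_(t in B) X t.
Proof. by move=> iX; rewrite RintegralZl//; exact: rintS. Qed.

Lemma Rint_le X Y : rint X -> rint Y -> (forall t, B t -> X t <= Y t) ->
  \int[P]_(t in B) X t <= \int[P]_(t in B) Y t.
Proof. by move=> iX iY XY; apply: le_Rintegral => //; exact: rintS. Qed.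

Lemma EFin_Rint X : rint X ->
  (\int[P]_(t in B) (X t)%:E)%E = (\int[P]_(t in B) X t)%:E.
Proof.
by move=> iX; rewrite /Rintegral fineK//; apply: integrable_fin_num => //; exact: rintS.
Qed.

Lemma Rint_sum (I : finType) (X : I -> T -> R) : (forall i, rint (X i)) ->
  \int[P]_(t in B) (\sum_i X i t) = \sum_i \int[P]_(t in B) X i t.
Proof.
move=> iX; apply: EFin_inj; rewrite -EFin_Rint; last exact: rint_sum.
rewrite -sumEFin; under eq_integral do rewrite -sumEFin.
rewrite integral_sum//; last by move=> i; exact: rintS.
by apply: eq_bigr => i _; rewrite EFin_Rint.
Qed.

End expectation.

Lemma Rint_subset X B : measurable B -> rint X -> (forall t, 0 <= X t) ->
  \int[P]_(t in B) X t <= \int[P]_t X t.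
Proof.
move=> mB iX X0; rewrite -lee_fin -!EFin_Rint//.
apply: ge0_subset_integral => //.
  by apply/measurable_EFinP; exact: rint_measurable.
by move=> t _; rewrite lee_fin.
Qed.

End square_integrable.

(** * Integrals against noise of conditional mean zero *)

Section conditional.
Context (R : realType) (d : measure_display) (T : measurableType d).
Context (P : probability T R) (Gen : set (set T)).
Hypothesis Gen_sub : <<s Gen >> `<=` measurable.
Let T' := g_sigma_algebraType Gen.

Lemma measurable_fun_sub (X : T' -> R) :
  measurable_fun [set: T'] X -> measurable_fun [set: T] (X : T -> R).
Proof.
move=> mX _ Y mY; rewrite setTI; apply: Gen_sub.
by rewrite -[X in <<s _ >> X]setTI; exact: mX.
Qed.

Variable s : T -> R.
Hypothesis s_sq : sqint P s.
Hypothesis s0 : forall B, <<s Gen >> B -> (\int[P]_(t in B) (s t)%:E = 0)%E.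

Lemma sigmaI A B : <<s Gen >> A -> <<s Gen >> B -> <<s Gen >> (A `&` B).
Proof. by move=> hA hB; exact: (@measurableI _ T' A B hA hB). Qed.

(** Each level set of [g], intersected with [B], is an event of the sub-sigma-algebra, over which
    [s] integrates to 0. *)
Lemma mean0_simple (g : {nnsfun T' >-> R}) B : <<s Gen >> B ->
  (\int[P]_(t in B) ((g : T' -> R) t * s t)%:E = 0)%E.
Proof.
move=> hB; have mB := Gen_sub hB.
pose r : seq R := finmap.enum_fset (fset_set (range (g : T' -> R))).
pose E (y : R) : set T := (g : T' -> R) @^-1` [set y].
have hE y : <<s Gen >> (E y).
  by rewrite -[E y]setTI; exact: (@measurable_funP _ _ _ _ setT g measurableT).
have iE y : rint P (fun t => y * (\1_(E y) t * s t)).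
  apply: rintZ; apply: sqint_mul => //.
  apply: (sqint_le (Y := fun=> 1)).
  - by apply: measurable_indic; exact: Gen_sub.
  - exact: rint_cst.
  - by move=> t; rewrite indicE; case: (_ \in _); rewrite ?expr1n ?expr0n.
transitivity (\int[P]_(t in B) (\sum_(y <- r) (y * (\1_(E y) t * s t))%:E))%E.
  apply: eq_integral => t _; rewrite (fimfunE g) fsbig_finite//= sumEFin mulr_suml.
  by congr (_%:E); apply: eq_bigr => y _; rewrite mulrA.
rewrite integral_sum//; last by move=> y; exact: rintS (iE y).
rewrite big1// => y _.
transitivity (\int[P]_(t in B) (y%:E * ((fun t => (s t)%:E) \_ (E y)) t))%E.
  apply: eq_integral => t _; rewrite EFinM; congr (_ * _)%E.
  by rewrite patchE indicE; case: (t \in E y); rewrite ?mul1r ?mul0r.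
rewrite integralZl//; first last.
  apply: (integrableS measurableT) => //.
  apply/(integrable_mkcond _ (Gen_sub (hE y))); apply: rintS.
    exact: Gen_sub.
  exact: sqint_rint.
by rewrite -integral_mkcondr s0 ?mule0//; exact: sigmaI.
Qed.

(** Simple functions increase to [h], and |h s| dominates; it is integrable as a product of
    square-integrable functions. *)
Lemma mean0_nonneg (h : T -> R) B : measurable_fun [set: T'] (h : T' -> R) ->
  sqint P h -> (forall t, 0 <= h t) -> <<s Gen >> B ->
  (\int[P]_(t in B) (h t * s t)%:E = 0)%E.
Proof.
move=> mh hsq h0 hB; have mB := Gen_sub hB.
have [g [gnd gcvg]] := @approximation _ T' R setT measurableT (EFin \o h)
  ((measurable_EFinP _ _).2 mh) (fun t _ => h0 t).
have gh n (t : T) : (g n : T' -> R) t <= h t.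
  have c : (fun n => g n t) @ \oo --> h t.
    exact: (fine_cvg (gcvg t I)).
  have nd : nondecreasing_seq (fun n => g n t).
    by move=> a b ab; have /lefP := gnd a b ab; apply.
  by rewrite -(cvg_lim _ c)//; apply: nondecreasing_cvgn_le => //; apply/cvg_ex; exists (h t).
have mg n : measurable_fun [set: T] (g n : T' -> R).
  by apply: measurable_fun_sub; exact: measurable_funP.
have [| | | | |_ _ dc] := @dominated_convergence _ _ _ P B mB
  (fun n t => ((g n : T' -> R) t * s t)%:E) (fun t => (h t * s t)%:E)
  (fun t => `|h t * s t|%:E).
- move=> n; apply: (@measurable_funS _ _ _ _ setT) => //; apply/measurable_EFinP.
  by apply: measurable_funM => //; exact: s_sq.1.
- apply: (@measurable_funS _ _ _ _ setT) => //; apply/measurable_EFinP.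
  by apply: measurable_funM; [exact: hsq.1|exact: s_sq.1].
- apply: nearW => t _; apply: cvg_EFin; first exact: nearW.
  apply: cvgM; last exact: cvg_cst.
  exact: (fine_cvg (gcvg t I)).
- apply: integrable_norm; apply: rintS => //; exact: sqint_mul.
- apply: nearW => t n _; rewrite lee_fin !normrM ler_wpM2r//.
  by rewrite !ger0_norm.
rewrite -(cvg_lim _ dc)// (_ : [sequence _]_n = cst 0%E) ?lim_cst//.
by apply/funext => n; exact: mean0_simple.
Qed.

(** The known factor is pulled out of the conditional expectation, E[h s | Gen] = h E[s | Gen] = 0,
    through the positive and negative parts of [h]. *)
Lemma mean0_mul (h : T -> R) B : measurable_fun [set: T'] (h : T' -> R) ->
  sqint P h -> <<s Gen >> B -> \int[P]_(t in B) (h t * s t) = 0.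
Proof.
move=> mh hsq hB; have mB := Gen_sub hB.
pose hp t := Num.max (h t) 0; pose hn t := Num.max (- h t) 0.
have mhp : measurable_fun [set: T'] (hp : T' -> R) by exact: measurable_maxr.
have mhn : measurable_fun [set: T'] (hn : T' -> R).
  by apply: measurable_maxr => //; exact: measurableT_comp.
have hpsq : sqint P hp.
  apply: (sqint_le _ hsq.2); first exact: measurable_fun_sub.
  by move=> t; rewrite /hp; case: (lerP (h t) 0) => _; rewrite ?expr0n ?sqr_ge0.
have hnsq : sqint P hn.
  apply: (sqint_le _ hsq.2); first exact: measurable_fun_sub.
  by move=> t; rewrite /hn; case: (lerP (- h t) 0) => _; rewrite ?expr0n ?sqr_ge0 ?sqrrN.
transitivity (\int[P]_(t in B) (hp t * s t + (-1) * (hn t * s t))).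
  apply: eq_Rintegral => t _; rewrite mulN1r -mulrBl; congr (_ * _).
  by rewrite /hp /hn; case: (lerP (h t) 0); case: (lerP (- h t) 0); lra.
have ihp := sqint_mul hpsq s_sq; have ihn := sqint_mul hnsq s_sq.
rewrite RintD//; last exact: rintZ.
rewrite RintZ// /Rintegral !mean0_nonneg// => [|t|t].
- by rewrite mulr0 addr0.
- by rewrite le_max lexx orbT.
- by rewrite le_max lexx orbT.
Qed.

End conditional.

(** * Consequences of conditional moment bounds *)

Section cond_exp_bounds.
Context (R : realType) (d : measure_display) (T : measurableType d).
Context (P : probability T R) (F : set (set T)).
Hypothesis F_sub : F `<=` measurable.

Lemma cond_exp_le_Rint X c B : cond_exp_le P F X c -> F B ->
  \int[P]_(t in B) X t <= c * fine (P B).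
Proof.
move=> [Y [[iX iY _ XY] Yc]] FB; have mB := F_sub FB.
have mY := rint_measurable iY.
(* The bound by [c] holds only almost everywhere; truncation makes it hold everywhere without
   changing the integral. *)
have mZ : measurable_fun setT (fun t => Num.min (Y t) c) by exact: measurable_minr.
have iZ : rint P (fun t => Num.min (Y t) c).
  apply: (@rint_le _ _ _ _ _ (fun t => `|Y t| + `|c|)) => //.
    by apply: rintD; [exact: integrable_norm|exact: rint_cst].
  move=> t; case: (lerP (Y t) c) => _; first by rewrite lerDl.
  by rewrite lerDr.
have -> : \int[P]_(t in B) X t = \int[P]_(t in B) Num.min (Y t) c.
  rewrite /Rintegral -XY//; congr fine; apply: ae_eq_integral => //.
  - apply: (@measurable_funS _ _ _ _ setT) => //; exact/measurable_EFinP.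
  - apply: (@measurable_funS _ _ _ _ setT) => //; exact/measurable_EFinP.
  - by apply: filterS Yc => t Yc _; rewrite min_l.
rewrite -Rintegral_cst//; apply: Rint_le => //; first exact: rint_cst.
by move=> t _; rewrite ge_min lexx orbT.
Qed.

(** In place of the conditional Jensen inequality, x^2 <= x^4 / (2 a) + a / 2 is integrated over the
    event, with a close to sigma^2. *)
Lemma fourth_moment_second (u : T -> R) (sigma : R) : measurable_fun setT u ->
  cond_exp_le P F (fun t => u t ^+ 4) (sigma ^+ 4) ->
  sqint P u /\ forall B, F B -> \int[P]_(t in B) (u t ^+ 2) <= sigma ^+ 2 * fine (P B).
Proof.
move=> mu h; have iu4 : rint P (fun t => u t ^+ 4) by have [Y [[]]] := h.
have young (x a : R) : 0 < a -> x ^+ 2 <= (2 * a)^-1 * x ^+ 4 + a / 2.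
  move=> a0; rewrite -subr_ge0.
  have -> : (2 * a)^-1 * x ^+ 4 + a / 2 - x ^+ 2 = (2 * a)^-1 * (x ^+ 2 - a) ^+ 2.
    by field; rewrite gt_eqF.
  by rewrite mulr_ge0 ?sqr_ge0// invr_ge0 mulr_ge0// ltW.
have iu a : rint P (fun t => (2 * a)^-1 * u t ^+ 4 + a / 2).
  by apply: rintD; [exact: rintZ|exact: rint_cst].
have usq : sqint P u by apply: (sqint_le mu (iu 1)) => t; exact: young.
split => // B FB; have mB := F_sub FB.
have PB0 : 0 <= fine (P B) by exact: fine_ge0.
have PB1 : fine (P B) <= 1.
  by rewrite -lee_fin fineK ?probability_le1// fin_num_measure.
(* a = sigma^2 would be optimal but may be 0, hence the additional e. *)
apply/ler_addgt0Pr => e e0; pose a := sigma ^+ 2 + e.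
have a0 : 0 < a by rewrite ltr_wpDl// sqr_ge0.
apply: (@le_trans _ _ (\int[P]_(t in B) ((2 * a)^-1 * u t ^+ 4 + a / 2))).
  by apply: Rint_le => //; [exact: usq.2|move=> t _; exact: young].
rewrite RintD//; [|exact: rintZ|exact: rint_cst].
rewrite (RintZ mB _ iu4) (Rintegral_cst P mB).
have h4 : (2 * a)^-1 * \int[P]_(t in B) (u t ^+ 4) <= sigma ^+ 2 / 2 * fine (P B).
  rewrite mulrC ler_pdivrMr ?mulr_gt0// (le_trans (cond_exp_le_Rint h FB))//.
  rewrite [leRHS](_ : _ = (sigma ^+ 2 * a) * fine (P B)); last by field.
  rewrite ler_wpM2r// /a; have := sqr_ge0 sigma; nra.
by rewrite (le_trans (lerD h4 (lexx _)))// /a; nra.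
Qed.

End cond_exp_bounds.

(** * One step of the recursion, outcome by outcome *)

Section aggregate_cost.
Context (R : realType) (M N : nat).
Variables (J : 'I_N -> 'rV[R]_M -> R) (A : 'M[R]_N) (p : 'cV[R]_N) (delta G : R).
Hypothesis J_diff : forall k, twice_differentiable (J k).
Hypothesis p_perron : perron_vector A p.
Hypothesis J_lip : lipschitz_gradients J delta.
Hypothesis J_dis : bounded_disagreement J G.
Hypothesis delta_ge0 : 0 <= delta.

Let p_ge0 k : 0 <= p k 0. Proof. by have [_ _ /(_ k)/ltW] := p_perron. Qed.
Let p_sum1 : \sum_k p k 0 = 1. Proof. by have [] := p_perron. Qed.

Lemma enorm_convex (v : 'I_N -> 'rV[R]_M) (c : R) :
  (forall k, enorm (v k) <= c) -> enorm (\sum_k p k 0 *: v k) <= c.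
Proof.
move=> vc; rewrite (le_trans (enorm_sum _))// -[leRHS]mul1r -p_sum1 mulr_suml.
by apply: ler_sum => k _; rewrite enormZ ger0_norm// ler_wpM2l.
Qed.

Lemma aggregateE : aggregate p J = \sum_k (p k 0 *: J k).
Proof. by apply/funext => x; rewrite fct_sumE. Qed.

Lemma aggregate_differentiable x : differentiable (aggregate p J) x.
Proof.
rewrite aggregateE; apply: differentiable_sum => k; apply: differentiableZ.
exact: (J_diff k x).1.
Qed.

Lemma grad_aggregate x : grad (aggregate p J) x = \sum_k p k 0 *: grad (J k) x.
Proof.
apply/rowP => j; rewrite mxE summxE aggregateE derive_sum => [|k].
  apply: eq_bigr => k _; rewrite !mxE deriveZ//.
  by apply: diff_derivable; exact: (J_diff k x).1.
by apply: derivableZ; apply: diff_derivable; exact: (J_diff k x).1.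
Qed.

Lemma aggregate_twice_differentiable : twice_differentiable (aggregate p J).
Proof.
move=> x; split; first exact: aggregate_differentiable.
rewrite (_ : grad _ = \sum_k (p k 0 *: grad (J k))); last first.
  by apply/funext => y; rewrite grad_aggregate fct_sumE.
apply: differentiable_sum => k; apply: differentiableZ.
exact: (J_diff k x).2.
Qed.

Lemma aggregate_lipschitz x y :
  enorm (grad (aggregate p J) x - grad (aggregate p J) y) <= delta * enorm (x - y).
Proof.
rewrite !grad_aggregate -sumrB; under eq_bigr do rewrite -scalerBr.
by apply: enorm_convex => k; exact: J_lip.
Qed.

(** Serves to integrate the costs. The descent lemma from 0 to x bounds above, from x to 0 below; in
    the latter, replacing the gradient at x by the one at 0 raises 1/2 to 3/2. *)
Lemma quadratic_growth (f : 'rV[R]_M -> R) x : (forall z, differentiable f z) ->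
  (forall a b, enorm (grad f a - grad f b) <= delta * enorm (a - b)) ->
  `|f x| <= `|f 0| + enorm (grad f 0) * enorm x + 3 / 2 * delta * enorm x ^+ 2.
Proof.
move=> df lip.
have h1 := @descent_lemma _ _ f delta 0 x df lip.
have h2 := @descent_lemma _ _ f delta x 0 df lip.
rewrite subr0 in h1; rewrite sub0r enormN in h2.
have d1 := dot_le (grad f 0) x; have d2 := dot_le (grad f x) (- x).
have l := enormD (grad f x - grad f 0) (grad f 0).
have l' := lip x 0; rewrite subrK in l; rewrite subr0 in l'.
rewrite enormN in d2.
have x0 := enorm_ge0 x.
have d3 : enorm (grad f x) * enorm x <= (delta * enorm x + enorm (grad f 0)) * enorm x.
  by rewrite ler_wpM2r//; lra.
have f1 := ler_norm (f 0); have f2 := ler_norm (- f 0); rewrite normrN in f2.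
have d4 : 0 <= delta * enorm x ^+ 2 by rewrite mulr_ge0 ?sqr_ge0.
rewrite mulrDl -mulrA -expr2 in d3.
by rewrite ler_norml; apply/andP; split; lra.
Qed.

Section one_step.
Variables (w s : 'I_N -> 'rV[R]_M) (mu : R).
Hypothesis mu_gt0 : 0 < mu.
Let W : 'M[R]_(N, M) := \matrix_k w k.
Let xc : 'rV[R]_M := \sum_k p k 0 *: w k.
Let F := aggregate p J.

Let d : 'rV[R]_M := \sum_k p k 0 *: (grad (J k) (w k) - grad (J k) xc).
Let sc : 'rV[R]_M := \sum_k p k 0 *: s k.

Lemma grad_at_agents : \sum_k p k 0 *: grad (J k) (w k) = grad F xc + d.
Proof.
rewrite grad_aggregate -big_split; apply: eq_bigr => k _.
by rewrite /= -scalerDr addrCA subrr addr0.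
Qed.

Lemma one_step_descent : 2 * mu * delta <= 1 ->
  F (xc - mu *: \sum_k p k 0 *: (grad (J k) (w k) + s k)) <=
  F xc - mu / 2 * enorm (grad F xc) ^+ 2 + mu / 2 * enorm d ^+ 2
  + delta * mu ^+ 2 / 2 * enorm sc ^+ 2
  + dot ((- mu) *: grad F xc + (delta * mu ^+ 2) *: (grad F xc + d)) sc.
Proof.
move=> mud.
have -> : \sum_k p k 0 *: (grad (J k) (w k) + s k) = grad F xc + d + sc.
  rewrite -grad_at_agents -big_split; apply: eq_bigr => k _.
  by rewrite /= scalerDr.
set g := grad F xc.
have := @descent_lemma _ _ F delta xc (xc - mu *: (g + d + sc))
  aggregate_differentiable aggregate_lipschitz.
have -> : xc - mu *: (g + d + sc) - xc = - (mu *: (g + d + sc)).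
  by rewrite addrAC subrr sub0r.
rewrite enormN enormZ exprMn real_normK ?num_real//.
have -> : dot g (- (mu *: (g + d + sc))) =
    - mu * (enorm g ^+ 2 + dot g d + dot g sc).
  rewrite -scaleNr dotZr !dotDr; congr (_ * (_ + _ + _)).
  by rewrite enorm_sq_rV; apply: eq_bigr => j _; rewrite expr2.
have -> : enorm (g + d + sc) ^+ 2 = enorm g ^+ 2 + 2 * dot g d + enorm d ^+ 2
    + 2 * (dot g sc + dot d sc) + enorm sc ^+ 2.
  by rewrite enorm_sqD (enorm_sqD g d) dotDl.
have -> : dot ((- mu) *: g + (delta * mu ^+ 2) *: (g + d)) sc =
    - mu * dot g sc + delta * mu ^+ 2 * (dot g sc + dot d sc).
  by rewrite dotDl !dotZl dotDl.
move=> h; apply: (le_trans h).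
have gd : 0 <= enorm g ^+ 2 + 2 * dot g d + enorm d ^+ 2.
  by rewrite -enorm_sqD sqr_ge0.
(* The claimed bound exceeds that of the descent lemma by exactly this coefficient times |g + d|^2;
   the noise terms agree. *)
have c0 : 0 <= mu * (1 - mu * delta) / 2.
  by rewrite divr_ge0// mulr_ge0 ?ltW//; lra.
have := mulr_ge0 c0 gd.
move: (enorm g ^+ 2) (enorm d ^+ 2) (enorm sc ^+ 2) (dot g d) (dot g sc) (dot d sc).
move=> *; nra.
Qed.

Variables (n : nat) (Q : 'M[R]_(n, N)) (S : 'M[R]_(N, n)).
Hypothesis SQ : S *m Q = 1%:M - const_mx 1 *m p^T.
Hypothesis Q1 : Q *m (const_mx 1 : 'cV_N) = 0.

Lemma row_disagreement k : row k (S *m (Q *m W)) = w k - xc.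
Proof.
rewrite mulmxA SQ mulmxBl mul1mx linearB /= rowK -mulmxA; congr (_ - _).
apply/rowP => j; rewrite !mxE big_ord1 mxE mul1r mxE summxE.
by apply: eq_bigr => l _; rewrite !mxE.
Qed.

Lemma disagreement_le k : enorm (w k - xc) <= enorm S * enorm (Q *m W).
Proof.
by rewrite -row_disagreement (le_trans (enorm_row_le _ _))// enorm_mulmx.
Qed.

Lemma gradient_deviation_le : enorm d <= delta * enorm S * enorm (Q *m W).
Proof.
apply: enorm_convex => k; rewrite (le_trans (J_lip _ _ _))// -mulrA.
by rewrite ler_wpM2l// disagreement_le.
Qed.

Lemma disagreement_step (rho : R) : 0 <= rho ->
  (forall m (Z : 'M[R]_(N, m)), enorm (Q *m (A^T *m Z)) <= rho * enorm (Q *m Z)) ->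
  0 <= G ->
  enorm (Q *m \matrix_k (\sum_l A l k *: (w l - mu *: (grad (J l) (w l) + s l)))) <=
  rho * ((1 + mu * (enorm Q * N%:R * delta * enorm S)) * enorm (Q *m W)
    + mu * (enorm Q * N%:R * G + enorm Q * enorm (\matrix_k s k))).
Proof.
move=> rho0 hrho G0.
pose Gr : 'M[R]_(N, M) := \matrix_k grad (J k) (w k).
pose Sm : 'M[R]_(N, M) := \matrix_k s k.
have -> : \matrix_k (\sum_l A l k *: (w l - mu *: (grad (J l) (w l) + s l)))
   = A^T *m (W - mu *: (Gr + Sm)) :> 'M[R]_(N, M).
  apply/matrixP => k j; rewrite !mxE summxE; apply: eq_bigr => l _.
  by rewrite !mxE.
rewrite (le_trans (hrho _ _))// ler_wpM2l//.
have QGr : enorm (Q *m Gr) <= enorm Q * (N%:R * (delta * (enorm S * enorm (Q *m W)) + G)).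
  (* As [Q] annihilates consensus, a common row may be subtracted. With the aggregate gradient at
     the centroid, each row is left with a Lipschitz error and a disagreement of at most [G]. *)
  have -> : Q *m Gr = Q *m (Gr - const_mx 1 *m grad F xc).
    by rewrite mulmxBr mulmxA Q1 mul0mx subr0.
  rewrite (le_trans (enorm_mulmx _ _))// ler_wpM2l ?enorm_ge0//.
  apply: enorm_le_rows.
    by rewrite addr_ge0// mulr_ge0// mulr_ge0 ?enorm_ge0.
  move=> k; rewrite linearB /= rowK.
  have -> : row k (const_mx 1 *m grad F xc) = grad F xc.
    by apply/rowP => j; rewrite !mxE big_ord1 !mxE mul1r.
  rewrite -[grad (J k) (w k)](subrK (grad (J k) xc)) -addrA.
  rewrite (le_trans (enormD _ _))// lerD//.
    by rewrite (le_trans (J_lip _ _ _))// ler_wpM2l// disagreement_le.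
  have -> : grad (J k) xc - grad F xc =
      \sum_l p l 0 *: (grad (J k) xc - grad (J l) xc).
    rewrite grad_aggregate; under [RHS]eq_bigr do rewrite scalerBr.
    by rewrite sumrB -scaler_suml p_sum1 scale1r.
  by apply: enorm_convex => l; exact: J_dis.
have QS := enorm_mulmx Q Sm.
rewrite mulmxBr -scalemxAr mulmxDr (le_trans (enormD _ _))// enormN enormZ.
rewrite ger0_norm ?(ltW mu_gt0)//.
have h := enormD (Q *m Gr) (Q *m Sm).
have : mu * enorm (Q *m Gr + Q *m Sm) <= mu *
    (enorm Q * (N%:R * (delta * (enorm S * enorm (Q *m W)) + G)) + enorm Q * enorm Sm).
  by rewrite ler_wpM2l ?(ltW mu_gt0)// (le_trans h)// lerD.
rewrite -/Sm => h2; apply: le_trans (lerD (lexx _) h2) _.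
rewrite le_eqVlt; apply/orP; left; apply/eqP.
ring.
Qed.

End one_step.

End aggregate_cost.

(* Convexity splits the square with weights t and 1 - t, where t = (1 + rho) / 2
   leaves room for the factor 1 + a mu to be absorbed. *)
Lemma perturbed_contraction_sq (R : realType) (rho a b mu y z : R) :
  0 <= rho -> rho < 1 -> 0 <= a -> 0 <= b -> 0 <= y -> 0 <= mu ->
  mu * a <= (1 - rho) / 8 -> 0 <= z ->
  z <= rho * ((1 + mu * a) * y + mu * b) ->
  z ^+ 2 <= rho * y ^+ 2 + 2 / (1 - rho) * mu ^+ 2 * b ^+ 2.
Proof.
move=> r0 r1 a0 b0 y0 mu0 mua z0 hz.
have t0 : 0 < 1 - rho by lra.
have ma0 : 0 <= mu * a by exact: mulr_ge0.
pose e := (1 + mu * a) * y; pose f := mu * b.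
have e0 : 0 <= e by rewrite mulr_ge0//; lra.
have f0 : 0 <= f by rewrite mulr_ge0.
have zz : z ^+ 2 <= rho ^+ 2 * (e + f) ^+ 2.
  rewrite -exprMn ler_pXn2r ?nnegrE//.
  by rewrite mulr_ge0// addr_ge0.
have cs : (e + f) ^+ 2 <= 2 / (1 + rho) * e ^+ 2 + 2 / (1 - rho) * f ^+ 2.
  rewrite -subr_ge0.
  have -> : 2 / (1 + rho) * e ^+ 2 + 2 / (1 - rho) * f ^+ 2 - (e + f) ^+ 2
     = ((1 - rho) * e - (1 + rho) * f) ^+ 2 / ((1 + rho) * (1 - rho)).
    by field; apply/andP; split; lra.
  by rewrite divr_ge0 ?sqr_ge0// mulr_ge0; lra.
have he : rho * (2 / (1 + rho) * e ^+ 2) <= y ^+ 2.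
  have -> : rho * (2 / (1 + rho) * e ^+ 2) = 2 * rho * e ^+ 2 / (1 + rho) by ring.
  rewrite ler_pdivrMr; last by lra.
  rewrite /e exprMn.
  have : (2 * rho) * (1 + mu * a) ^+ 2 <= 1 + rho.
    (* For v = mu a <= (1 - rho) / 8 one has v^2 <= v; then 2 rho (1 + 3 (1 - rho) / 8) <= 1 + rho
       because 3 rho / 4 <= 1. *)
    have : (1 + mu * a) ^+ 2 <= 1 + 3 * ((1 - rho) / 8).
      move: (mu * a) mua ma0 => v; nra.
    nra.
  have := sqr_ge0 y; nra.
have hf : 0 <= 2 / (1 - rho) * f ^+ 2 by rewrite mulr_ge0 ?sqr_ge0// divr_ge0; lra.
rewrite (le_trans zz)//.
have -> : 2 / (1 - rho) * mu ^+ 2 * b ^+ 2 = 2 / (1 - rho) * f ^+ 2.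
  by rewrite /f; ring.
move: cs he hf; set E := 2 / (1 + rho) * e ^+ 2; set H := _ * f ^+ 2 => cs he hf.
have r2 : rho ^+ 2 * (e + f) ^+ 2 <= rho ^+ 2 * (E + H) by rewrite ler_wpM2l ?sqr_ge0.
have rH : rho ^+ 2 * H <= H by rewrite -[leRHS]mul1r ler_wpM2r//; nra.
have rE : rho ^+ 2 * E <= rho * y ^+ 2 by rewrite expr2 -mulrA ler_wpM2l.
lra.
Qed.

(** * Moments of the iterates *)

Section random_matrices.
Context (R : realType) (d : measure_display) (T : measurableType d).

Lemma measurable_enorm m n (X : T -> 'M[R]_(m, n)) :
  (forall i j, measurable_fun setT (fun t => X t i j)) ->
  measurable_fun setT (fun t => enorm (X t)).
Proof.
move=> mX; rewrite (_ : (fun t => _) =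
  Num.sqrt \o (fun t => \sum_i \sum_j X t i j ^+ 2))//; apply: measurableT_comp.
  by apply: continuous_measurable_fun; exact: sqrt_continuous.
apply: measurable_sum => i; apply: measurable_sum => j.
exact: measurable_funX.
Qed.

Lemma entry_sq_le m n (x : 'M[R]_(m, n)) i j : x i j ^+ 2 <= enorm x ^+ 2.
Proof.
rewrite enorm_sq (bigD1 i)//= (bigD1 j)//= -addrA lerDl addr_ge0//.
  by apply: sumr_ge0 => k _; exact: sqr_ge0.
by apply: sumr_ge0 => k _; apply: sumr_ge0 => l _; exact: sqr_ge0.
Qed.

Context (P : probability T R).

Lemma sqint_enorm m n (X : T -> 'M[R]_(m, n)) :
  (forall i j, sqint P (fun t => X t i j)) -> sqint P (fun t => enorm (X t)).
Proof.
move=> iX; split; first by apply: measurable_enorm => i j; exact: (iX i j).1.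
under eq_fun do rewrite enorm_sq.
by apply: rint_sum => i; apply: rint_sum => j; exact: (iX i j).2.
Qed.

Lemma sqint_entry m n (X : T -> 'M[R]_(m, n)) i j :
  measurable_fun setT (fun t => X t i j) -> sqint P (fun t => enorm (X t)) ->
  sqint P (fun t => X t i j).
Proof. by move=> mX [_ iX]; apply: (sqint_le mX iX) => t; exact: entry_sq_le. Qed.

Lemma sqint_mulmx m n p (Q : 'M[R]_(m, n)) (X : T -> 'M[R]_(n, p)) :
  (forall i j, sqint P (fun t => X t i j)) ->
  forall i j, sqint P (fun t => (Q *m X t) i j).
Proof.
move=> iX i j; under eq_fun do rewrite mxE.
by apply: sqint_sum => k; exact: sqintZ.
Qed.

Lemma measurable_grad M (f : 'rV[R]_M -> R) (X : T -> 'rV[R]_M) :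
  twice_differentiable f -> (forall j, measurable_fun setT (fun t => X t 0 j)) ->
  forall j, measurable_fun setT (fun t => grad f (X t) 0 j).
Proof.
move=> df mX j; apply: (measurable_comp_continuous mX (f := fun x => grad f x 0 j)).
exact: continuous_grad.
Qed.

Section lipschitz.
Context (M : nat) (f : 'rV[R]_M -> R) (delta : R).
Hypothesis df : twice_differentiable f.
Hypothesis delta_ge0 : 0 <= delta.
Hypothesis lip : forall a b, enorm (grad f a - grad f b) <= delta * enorm (a - b).
Variable X : T -> 'rV[R]_M.
Hypothesis iX : forall j, sqint P (fun t => X t 0 j).

Let sqint_X : sqint P (fun t => enorm (X t)).
Proof. by apply: sqint_enorm => i j; rewrite ord1. Qed.

Lemma sqint_grad j : sqint P (fun t => grad f (X t) 0 j).
Proof.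
have mg := measurable_grad df (fun j => (iX j).1).
apply: (sqint_le (mg j)
  (sqintD (sqint_cst P (enorm (grad f 0))) (sqintZ delta sqint_X)).2) => t.
rewrite (le_trans (entry_sq_le _ _ _))// ler_pXn2r ?nnegrE ?enorm_ge0//.
  rewrite -{1}[grad f (X t)](subrK (grad f 0)) (le_trans (enormD _ _))// addrC lerD2l.
  by rewrite (le_trans (lip _ _))// subr0.
by rewrite addr_ge0 ?enorm_ge0// mulr_ge0// enorm_ge0.
Qed.

Lemma rint_cost : rint P (f \o X).
Proof.
apply: (@rint_le _ _ _ _ _ (fun t => `|f 0| + enorm (grad f 0) * enorm (X t)
    + 3 / 2 * delta * enorm (X t) ^+ 2)).
- apply: measurable_comp_continuous; first by move=> j; exact: (iX j).1.
  by move=> x; apply: differentiable_continuous; exact: (df x).1.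
- apply: rintD; last by apply: rintZ; exact: sqint_X.2.
  by apply: rintD; [exact: rint_cst|apply: rintZ; exact: sqint_rint].
- by move=> t; apply: quadratic_growth => // z; exact: (df z).1.
Qed.

End lipschitz.

End random_matrices.

(** * The sigma-algebra of the past *)

Section history.
Context (R : realType) (M N : nat) (d : measure_display) (T : measurableType d).
Variable w : nat -> 'I_N -> T -> 'rV[R]_M.

(* history w i is convertible to <<s history_gen i >>; naming the generator gives
   access to the measurable type of the past, g_sigma_algebraType. *)
Definition history_gen (i : nat) : set (set T) :=
  [set B | exists j k m (S : set R),
     [/\ (j <= i)%N, measurable S & B = [set t | S (w j k t 0 m)]]].

Lemma history_measurable i :
  (forall j, (j <= i)%N -> forall k m, measurable_fun setT (fun t => w j k t 0 m)) ->
  history w i `<=` measurable.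
Proof.
move=> mw; apply: smallest_sub; first exact: sigma_algebra_measurable.
move=> _ [j [k [m [S [ji mS ->]]]]].
by rewrite -[X in measurable X]setTI; exact: mw.
Qed.

Lemma measurable_history i j k m : (j <= i)%N ->
  measurable_fun [set: g_sigma_algebraType (history_gen i)] (fun t => w j k t 0 m).
Proof.
move=> ji _ S mS; rewrite setTI; apply: sub_sigma_algebra.
by exists j, k, m, S.
Qed.

End history.

(** * Square-integrability along the diffusion recursion *)

Section diffusion_moments.
Context (R : realType) (M N : nat) (d : measure_display) (T : measurableType d).
Context (P : probability T R).
Variables (J : 'I_N -> 'rV[R]_M -> R) (A : 'M[R]_N) (p : 'cV[R]_N).
Variables (delta G sigma : R).
Variables (ghat : nat -> 'I_N -> 'rV[R]_M -> T -> 'rV[R]_M) (w0 : 'I_N -> T -> 'rV[R]_M).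
Hypothesis J_diff : forall k, twice_differentiable (J k).
Hypothesis p_perron : perron_vector A p.
Hypothesis J_lip : lipschitz_gradients J delta.
Hypothesis J_dis : bounded_disagreement J G.
Hypothesis delta_ge0 : 0 <= delta.
Hypothesis w0_init : initial_iterate P w0.

Variable mu : R.
Hypothesis mu_gt0 : 0 < mu.
Let w := diffusion A ghat w0 mu.
Hypothesis w_noise : gradient_noise P J ghat w sigma.
Let s := noise J ghat w.
Let F := aggregate p J.

Lemma diffusion_step i k t : w i.+1 k t =
  \sum_l A l k *: (w i l t - mu *: (grad (J l) (w i l t) + s i.+1 l t)).
Proof. by apply: eq_bigr => l _; rewrite /s /noise /= addrCA subrr addr0. Qed.

Lemma diffusion_step_entry i k t m : w i.+1 k t 0 m = \sum_l A l k *
  (w i l t 0 m + (- mu) * (grad (J l) (w i l t) 0 m + s i.+1 l t 0 m)).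
Proof.
rewrite diffusion_step summxE; apply: eq_bigr => l _.
move: (grad (J l) (w i l t)) (s i.+1 l t) (w i l t) => g e x.
by rewrite !mxE mulNr.
Qed.

Lemma centroid_step i t : centroid p (w i.+1) t =
  centroid p (w i) t - mu *: \sum_k p k 0 *: (grad (J k) (w i k t) + s i.+1 k t).
Proof.
rewrite /centroid; under eq_bigr do rewrite diffusion_step scaler_sumr.
rewrite exchange_big /= scaler_sumr -sumrB; apply: eq_bigr => l _.
under eq_bigr do rewrite scalerA mulrC.
rewrite -scaler_suml; have -> : \sum_k A l k * p k 0 = p l 0.
  by have [Ap _ _] := p_perron; rewrite -{2}Ap mxE.
by rewrite scalerBr !scalerA mulrC.
Qed.

Lemma initial_sqint k m : sqint P (fun t => w0 k t 0 m).
Proof.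
have [mw0] := w0_init; rewrite unlock => fin4.
pose X t : 'M[R]_(N, M) := \matrix_k w0 k t.
have mX i j : measurable_fun setT (fun t => X t i j).
  by under eq_fun do rewrite mxE; exact: mw0.
have mu4 : measurable_fun setT (fun t => enorm (X t) ^+ 4).
  by apply: measurable_funX; exact: measurable_enorm.
have i4 : rint P (fun t => enorm (X t) ^+ 4).
  apply/integrableP; split; first exact/measurable_EFinP.
  apply: le_lt_trans fin4; apply: ge0_le_integral => //.
  - by apply: measurableT_comp => //; exact/measurable_EFinP.
  - exact/measurable_EFinP.
  - by move=> t _; rewrite gee0_abs// lee_fin exprn_ge0// enorm_ge0.
have : sqint P (fun t => enorm (X t)).
  apply: (sqint_le (measurable_enorm mX) (rintD (rint_cst P 1) i4)) => t.
  by have := sqr_ge0 (enorm (X t) ^+ 2 - 1); have := sqr_ge0 (enorm (X t)); nra.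
by move=> /(sqint_entry (mX k m)); under eq_fun do rewrite mxE.
Qed.

Section noise_moments.
Variable i : nat.
Hypothesis H_sub : history w i `<=` measurable.

(** Measurability of the past is still a hypothesis here: [iterates_sqint] obtains it at time i from
    its induction hypothesis and only then uses this moment. *)
Lemma noise_second_moment k : sqint P (fun t => enorm (s i.+1 k t)) /\
  forall B, history w i B ->
    \int[P]_(t in B) (enorm (s i.+1 k t) ^+ 2) <= sigma ^+ 2 * fine (P B).
Proof.
have [s0 s4 _] := w_noise (ltn0Sn i).
apply: (fourth_moment_second H_sub _ (s4 k)).
apply: measurable_enorm => a m; rewrite ord1.
by have [is0 _ _ _] := s0 k m; exact: rint_measurable is0.
Qed.

Lemma noise_sqint k m : sqint P (fun t => s i.+1 k t 0 m).
Proof.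
have [s0 _ _] := w_noise (ltn0Sn i); have [is0 _ _ _] := s0 k m.
apply: sqint_entry; first exact: rint_measurable is0.
exact: (noise_second_moment k).1.
Qed.

Lemma noise_mean0 k m (h : T -> R) B :
  measurable_fun [set: g_sigma_algebraType (history_gen w i)] h -> sqint P h ->
  history w i B -> \int[P]_(t in B) (h t * s i.+1 k t 0 m) = 0.
Proof.
move=> mh hsq hB; apply: (mean0_mul (Gen := history_gen w i)) => //.
  exact: noise_sqint.
move=> B' hB'; have [s0 _ _] := w_noise (ltn0Sn i); have [_ _ _ <-//] := s0 k m.
by rewrite integral0.
Qed.

End noise_moments.

(** The induction is strong because the sigma-algebra of the past involves all earlier iterates. *)
Lemma iterates_sqint i : forall k m, sqint P (fun t => w i k t 0 m).
Proof.
elim/ltn_ind: i => -[_ k m|i IH k m]; first exact: initial_sqint.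
have H_sub : history w i `<=` measurable.
  by apply: history_measurable => j ji k' m'; exact: (IH j _ k' m').1.
under eq_fun do rewrite diffusion_step_entry.
apply: sqint_sum => l; apply: sqintZ; apply: sqintD; first exact: IH.
apply: sqintZ; apply: sqintD; last exact: noise_sqint.
by apply: (sqint_grad (J_diff l) delta_ge0 (J_lip l)) => j; exact: IH.
Qed.

Lemma history_sub i : history w i `<=` measurable.
Proof. by apply: history_measurable => j _ k m; exact: (iterates_sqint j k m).1. Qed.

Lemma centroid_sqint i j : sqint P (fun t => centroid p (w i) t 0 j).
Proof.
under eq_fun do rewrite summxE; apply: sqint_sum => k.
by under eq_fun do rewrite mxE; apply: sqintZ; exact: iterates_sqint.
Qed.

Lemma centroid_history i j :
  measurable_fun [set: g_sigma_algebraType (history_gen w i)]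
    (fun t => centroid p (w i) t 0 j).
Proof.
under eq_fun do rewrite summxE; apply: measurable_sum => k.
under eq_fun do rewrite mxE; apply: measurable_funM => //.
exact: measurable_history.
Qed.

Lemma noise_total_second_moment i :
  \int[P]_t (enorm (\matrix_k s i.+1 k t) ^+ 2) <= N%:R * sigma ^+ 2.
Proof.
under eq_Rintegral do rewrite enorm_row_sq.
have sq k := noise_second_moment (history_sub (i := i)) k.
rewrite Rint_sum//; last by move=> k; under eq_fun do rewrite rowK; exact: (sq k).1.2.
rewrite mulr_natl -[N in leRHS]card_ord -sumr_const; apply: ler_sum => k _.
under eq_Rintegral do rewrite rowK.
rewrite (le_trans ((sq k).2 setT _))//.
  exact: (@measurableT _ (g_sigma_algebraType (history_gen w i))).
by rewrite probability_setT mulr1.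
Qed.

(** * Mean-square disagreement and descent on past events *)

Section disagreement.
Variables (n : nat) (Q : 'M[R]_(n, N)) (S : 'M[R]_(N, n)) (rho : R).
Hypothesis SQ : S *m Q = 1%:M - const_mx 1 *m p^T.
Hypothesis Q1 : Q *m (const_mx 1 : 'cV_N) = 0.
Hypothesis rho_ge0 : 0 <= rho.
Hypothesis rho_lt1 : rho < 1.
Hypothesis Q_contr :
  forall m (Z : 'M[R]_(N, m)), enorm (Q *m (A^T *m Z)) <= rho * enorm (Q *m Z).
Hypothesis G_ge0 : 0 <= G.
Hypothesis mu_small : mu * (enorm Q * N%:R * delta * enorm S) <= (1 - rho) / 8.

Definition disagreement i t : R := enorm (Q *m \matrix_k w i k t).

Lemma disagreement_sqint i : sqint P (disagreement i).
Proof.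
apply: sqint_enorm; apply: sqint_mulmx => k m.
by under eq_fun do rewrite mxE; exact: iterates_sqint.
Qed.

(** The coefficient of mu^2 left by [perturbed_contraction_sq], once the square of the gradient and
    noise terms is split as 2 x^2 + 2 y^2 and the noise averaged. It does not depend on [mu]. *)
Definition disagreement_drift : R := 2 / (1 - rho) *
  (2 * (enorm Q * N%:R * G) ^+ 2 + 2 * enorm Q ^+ 2 * (N%:R * sigma ^+ 2)).

Lemma disagreement_recursion i :
  \int[P]_t (disagreement i.+1 t ^+ 2) <=
  rho * \int[P]_t (disagreement i t ^+ 2) + disagreement_drift * mu ^+ 2.
Proof.
have rho1 : 0 < 1 - rho by rewrite subr_gt0.
pose S2 t := enorm (\matrix_k s i.+1 k t) ^+ 2.
have iS2 : rint P S2.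
  rewrite /S2; apply: (sqint_enorm _).2 => k m; under eq_fun do rewrite mxE.
  by apply: noise_sqint; exact: history_sub.
pose c := 2 / (1 - rho) * mu ^+ 2.
have c0 : 0 <= c by rewrite mulr_ge0 ?sqr_ge0// divr_ge0// ltW.
have iD j := (disagreement_sqint j).2.
apply: (@le_trans _ _ (\int[P]_t (rho * disagreement i t ^+ 2
    + (c * (2 * (enorm Q * N%:R * G) ^+ 2) + c * (2 * enorm Q ^+ 2) * S2 t)))).
  apply: Rint_le => //.
    apply: rintD; first exact: rintZ.
    by apply: rintD; [exact: rint_cst|exact: rintZ].
  move=> t _; have := @perturbed_contraction_sq R rho
    (enorm Q * N%:R * delta * enorm S)
    (enorm Q * N%:R * G + enorm Q * enorm (\matrix_k s i.+1 k t)) mu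
    (disagreement i t) (disagreement i.+1 t) rho_ge0 rho_lt1.
  have := enorm_ge0 Q; have := enorm_ge0 S; have := enorm_ge0 (\matrix_k s i.+1 k t).
  set q := enorm Q; set b := enorm S; set z := enorm _ => z0 b0 q0 h.
  have {}h := h _ _ (enorm_ge0 _) (ltW mu_gt0) mu_small (enorm_ge0 _) _.
  apply: (le_trans (h _ _ _)).
  - by rewrite !mulr_ge0.
  - by rewrite addr_ge0// !mulr_ge0.
  - rewrite {1}/disagreement.
    have -> : \matrix_k w i.+1 k t = \matrix_k (\sum_l A l k *:
        (w i l t - mu *: (grad (J l) (w i l t) + s i.+1 l t))).
      by apply/row_matrixP => k; rewrite !rowK diffusion_step.
    exact: (@disagreement_step R M N J A p delta G J_diff p_perron J_lip J_dis
      delta_ge0 (w i ^~ t) (s i.+1 ^~ t) mu mu_gt0 n Q S SQ Q1 rho).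
  rewrite lerD2l -/c /S2 -/z.
  have sq : (q * N%:R * G + q * z) ^+ 2 <= 2 * (q * N%:R * G) ^+ 2 + 2 * q ^+ 2 * z ^+ 2.
    by have := sqr_ge0 (q * N%:R * G - q * z); nra.
  by rewrite (le_trans (ler_wpM2l c0 sq))// mulrDr (mulrA c (2 * q ^+ 2)).
have iC : rint P (fun t => c * (2 * (enorm Q * N%:R * G) ^+ 2)
    + c * (2 * enorm Q ^+ 2) * S2 t).
  by apply: rintD; [exact: rint_cst|exact: rintZ].
rewrite RintD//; last exact: rintZ.
rewrite RintZ// lerD2l RintD//; [|exact: rint_cst|exact: rintZ].
rewrite (RintZ measurableT (c * (2 * enorm Q ^+ 2)) iS2) (Rintegral_cst P measurableT).
have PT : fine (P setT) = 1 by rewrite probability_setT.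
rewrite PT mulr1.
have h : c * (2 * enorm Q ^+ 2) * \int[P]_t S2 t <=
    c * (2 * enorm Q ^+ 2) * (N%:R * sigma ^+ 2).
  apply: ler_wpM2l; last exact: noise_total_second_moment.
  exact: (mulr_ge0 c0 (mulr_ge0 (ler0n _ 2) (sqr_ge0 _))).
rewrite (le_trans (lerD (lexx _) h))// /disagreement_drift /c.
by rewrite le_eqVlt; apply/orP; left; apply/eqP; ring.
Qed.

(** [disagreement_drift / (1 - rho)] is the fixed point of x -> rho x + [disagreement_drift], so it
    survives the induction. *)
Lemma disagreement_moment i :
  \int[P]_t (disagreement i t ^+ 2) <=
  rho ^+ i * \int[P]_t (enorm (Q *m \matrix_k w0 k t) ^+ 2)
  + disagreement_drift / (1 - rho) * mu ^+ 2.
Proof.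
have rho1 : 0 < 1 - rho by rewrite subr_gt0.
have D0 : 0 <= disagreement_drift.
  apply: mulr_ge0; first by rewrite divr_ge0// ltW.
  apply: addr_ge0; first exact: mulr_ge0 (ler0n _ 2) (sqr_ge0 _).
  apply: mulr_ge0; first exact: mulr_ge0 (ler0n _ 2) (sqr_ge0 _).
  exact: mulr_ge0 (ler0n _ N) (sqr_ge0 _).
elim: i => [|i IH].
  by rewrite expr0 mul1r lerDl; exact: mulr_ge0 (divr_ge0 D0 (ltW rho1)) (sqr_ge0 _).
rewrite (le_trans (disagreement_recursion i))//.
rewrite (exprS rho i); have {}IH := ler_wpM2l rho_ge0 IH.
apply: le_trans (lerD IH (lexx _)) _; rewrite le_eqVlt; apply/orP; left; apply/eqP; field; lra.
Qed.

Hypothesis mu_delta : 2 * mu * delta <= 1.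

(** [kappa] lets one statement serve both sets: mu^2 c_2 (1 + 1 / varpi) where the gradient is
    large, 0 on the other. *)
Lemma descent_on_event i B kappa : history w i B ->
  (forall t, B t -> kappa <= mu / 2 * enorm (grad F (centroid p (w i) t)) ^+ 2) ->
  \int[P]_(t in B) F (centroid p (w i.+1) t) <=
  \int[P]_(t in B) F (centroid p (w i) t)
  + (mu ^+ 2 * c2 delta sigma - kappa) * fine (P B)
  + mu / 2 * (delta * enorm S) ^+ 2 * \int[P]_t (disagreement i t ^+ 2).
Proof.
move=> hB hk; have mB : measurable B := history_sub hB.
have [_ p_sum1 p_gt0] := p_perron.
pose x t := centroid p (w i) t.
(* [q] is the averaged gradient at the agents, so that [h] is the coefficient of the noise in
   [one_step_descent], a function of the iterates at time i. *)
pose q t := \sum_k p k 0 *: grad (J k) (w i k t).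
pose h t := (- mu) *: grad F (x t) + (delta * mu ^+ 2) *: q t.
have hE t j : h t 0 j = (- mu) * grad F (x t) 0 j
    + (delta * mu ^+ 2) * \sum_k p k 0 * grad (J k) (w i k t) 0 j.
  rewrite /h /q; move: (grad F (x t)) => g; rewrite 3!mxE; congr (_ + _ * _).
  by rewrite summxE; apply: eq_bigr => k _; move: (grad _ _) => gk; rewrite mxE.
have Fdiff : twice_differentiable F by exact: aggregate_twice_differentiable.
have Flip : forall a b, enorm (grad F a - grad F b) <= delta * enorm (a - b).
  by move=> a b; exact: (aggregate_lipschitz J_diff p_perron J_lip).
have ix j : sqint P (fun t => x t 0 j) by exact: centroid_sqint.
have ih j : sqint P (fun t => h t 0 j).
  under eq_fun do rewrite hE; apply: sqintD; apply: sqintZ.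
    exact: (sqint_grad Fdiff delta_ge0 Flip ix).
  apply: sqint_sum => k; apply: sqintZ.
  by apply: (sqint_grad (J_diff k) delta_ge0 (J_lip k)) => m; exact: iterates_sqint.
have mh j : measurable_fun [set: g_sigma_algebraType (history_gen w i)] (fun t => h t 0 j).
  under eq_fun do rewrite hE; apply: measurable_funD; apply: measurable_funM => //.
    by apply: measurable_grad => // m; exact: centroid_history.
  apply: measurable_sum => k; apply: measurable_funM => //.
  by apply: measurable_grad => // m; exact: measurable_history.
pose D t := disagreement i t ^+ 2.
have iD : rint P D by exact: (disagreement_sqint i).2.
pose V t := \sum_k p k 0 * enorm (s i.+1 k t) ^+ 2.
have is2 k : rint P (fun t => enorm (s i.+1 k t) ^+ 2).
  exact: (noise_second_moment (history_sub (i := i)) k).1.2.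
have iV : rint P V by apply: rint_sum => k; exact: rintZ.
pose hs j k t := h t 0 j * s i.+1 k t 0 j.
have ihs j k : rint P (hs j k).
  by apply: sqint_mul => //; apply: noise_sqint; exact: history_sub.
pose H t := \sum_j \sum_k p k 0 * hs j k t.
have iH : rint P H by apply: rint_sum => j; apply: rint_sum => k; exact: rintZ.
have ic f : rint P (fun t => F (centroid p (w f) t)).
  by apply: (rint_cost Fdiff delta_ge0 Flip) => j; exact: centroid_sqint.
pose cD := mu / 2 * (delta * enorm S) ^+ 2.
pose cV := delta * mu ^+ 2 / 2.
have cD0 : 0 <= cD by rewrite mulr_ge0 ?sqr_ge0// divr_ge0// ltW.
have cV0 : 0 <= cV by rewrite divr_ge0// mulr_ge0 ?sqr_ge0.
have iVH : rint P (fun t => cV * V t + H t) by apply: rintD => //; exact: rintZ.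
have iDVH : rint P (fun t => cD * D t + (cV * V t + H t)) by apply: rintD => //; exact: rintZ.
have ikDVH : rint P (fun t => - kappa + (cD * D t + (cV * V t + H t))).
  by apply: rintD => //; exact: rint_cst.
have HE t : dot (h t) (\sum_k p k 0 *: s i.+1 k t) = H t.
  apply: eq_bigr => j _; rewrite summxE mulr_sumr; apply: eq_bigr => k _.
  have -> : (p k 0 *: s i.+1 k t) 0 j = p k 0 * s i.+1 k t 0 j.
    by move: (s i.+1 k t) => v; rewrite mxE.
  by rewrite mulrCA.
have VE t : enorm (\sum_k p k 0 *: s i.+1 k t) ^+ 2 <= V t.
  have e0 := enorm_ge0 (\sum_k p k 0 *: s i.+1 k t).
  have e1 : enorm (\sum_k p k 0 *: s i.+1 k t) <= \sum_k p k 0 * enorm (s i.+1 k t).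
    rewrite (le_trans (enorm_sum _))//; apply: ler_sum => k _.
    by rewrite enormZ ger0_norm// ltW.
  have : enorm (\sum_k p k 0 *: s i.+1 k t) ^+ 2 <=
      (\sum_k p k 0 * enorm (s i.+1 k t)) ^+ 2.
    by rewrite ler_pXn2r ?nnegrE// (le_trans e0).
  move=> /le_trans; apply; set m := \sum_k p k 0 * enorm (s i.+1 k t).
  (* Nonnegativity of the variance of the noise norms under the weights [p]. *)
  have : 0 <= \sum_k p k 0 * (enorm (s i.+1 k t) - m) ^+ 2.
    by apply: sumr_ge0 => k _; rewrite mulr_ge0 ?sqr_ge0// ltW.
  have -> : \sum_k p k 0 * (enorm (s i.+1 k t) - m) ^+ 2
      = V t - 2 * m * m + m ^+ 2 * \sum_k p k 0.
    transitivity (\sum_k (p k 0 * enorm (s i.+1 k t) ^+ 2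
        - 2 * m * (p k 0 * enorm (s i.+1 k t)) + m ^+ 2 * p k 0)).
      by apply: eq_bigr => k _; ring.
    by rewrite big_split sumrB /= -!mulr_sumr.
  by rewrite p_sum1 mulr1; lra.
apply: (@le_trans _ _ (\int[P]_(t in B)
    (F (x t) + (- kappa + (cD * D t + (cV * V t + H t)))))).
  apply: (Rint_le mB (ic i.+1) (rintD (ic i) ikDVH)).
  move=> t Bt; rewrite centroid_step.
  have d1 := one_step_descent J_diff p_perron J_lip (w i ^~ t) (s i.+1 ^~ t) mu_gt0 mu_delta.
  have d2 := gradient_deviation_le p_perron J_lip delta_ge0 (w i ^~ t) SQ.
  move: d1; rewrite /= -(grad_at_agents p J_diff) -/(x t) -/(q t) -/(h t) HE.
  move: d2; rewrite -/(disagreement i t) -/(x t).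
  set dv := enorm (\sum_k _) => d2; rewrite -/F => d1; apply: (le_trans d1).
  have dv2 : dv ^+ 2 <= (delta * enorm S) ^+ 2 * D t.
    rewrite /D -exprMn ler_pXn2r ?nnegrE ?enorm_ge0//.
    by rewrite mulr_ge0 ?enorm_ge0// mulr_ge0 ?enorm_ge0.
  have e1 : mu / 2 * dv ^+ 2 <= cD * D t.
    by rewrite /cD -(mulrA (mu / 2)) ler_wpM2l// divr_ge0// ltW.
  have e2 : delta * mu ^+ 2 / 2 * enorm (\sum_k p k 0 *: s i.+1 k t) ^+ 2 <= cV * V t.
    by rewrite ler_wpM2l.
  have := hk t Bt; rewrite -/(x t); move: e1 e2; lra.
rewrite (RintD mB (ic i) ikDVH) -addrA lerD2l.
rewrite (RintD mB (rint_cst P _) iDVH) (Rintegral_cst P mB).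
rewrite (RintD mB (rintZ cD iD) iVH) (RintZ mB cD iD).
rewrite (RintD mB (rintZ cV iV) iH) (RintZ mB cV iV).
have -> : \int[P]_(t in B) H t = 0.
  rewrite /H Rint_sum//; last by move=> j; apply: rint_sum => k; exact: rintZ.
  rewrite big1// => j _; rewrite Rint_sum//; last by move=> k; exact: rintZ.
  rewrite big1// => k _; rewrite RintZ// noise_mean0 ?mulr0//.
  exact: history_sub.
have hV : \int[P]_(t in B) V t <= sigma ^+ 2 * fine (P B).
  rewrite /V Rint_sum//; last by move=> k; exact: rintZ.
  rewrite -[leRHS]mul1r -p_sum1 mulr_suml; apply: ler_sum => k _.
  rewrite RintZ// ler_wpM2l ?(ltW (p_gt0 k))//.
  exact: (noise_second_moment (history_sub (i := i)) k).2.
(* The disagreement is controlled only over all outcomes, so its share is not proportional to P B;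
   hence the division of the O(mu^3) term by this probability. *)
have hD : \int[P]_(t in B) D t <= \int[P]_t D t.
  by apply: Rint_subset => // t; exact: sqr_ge0.
have := ler_wpM2l cD0 hD; have := ler_wpM2l cV0 hV.
rewrite /c2 -/cD /cV addr0 => *; lra.
Qed.

End disagreement.

End diffusion_moments.

(** * The conditional descent inequalities *)

Lemma exp_given_le (R : realType) (d : measure_display) (T : measurableType d)
    (P : probability T R) (X Y : T -> R) (B : set T) (a e : R) :
  measurable B -> rint P X -> rint P Y -> P B != 0%E ->
  \int[P]_(t in B) X t <= \int[P]_(t in B) Y t + a * fine (P B) + e ->
  (exp_given P X B <= exp_given P Y B + (a + e / fine (P B))%:E)%E.
Proof.
move=> mB iX iY PB0 h; rewrite /exp_given !EFin_Rint// -!EFinM -EFinD lee_fin.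
have b0 : 0 < fine (P B).
  rewrite lt0r fine_ge0// andbT; apply: contra PB0 => /eqP PB0.
  by rewrite -(fineK (fin_num_measure P _ mB)) PB0.
rewrite ler_pdivrMr// (le_trans h)// le_eqVlt; apply/orP; left; apply/eqP.
by field; rewrite gt_eqF.
Qed.

Section partition_measurability.
Context (R : realType) (d : measure_display) (T : measurableType d) (M : nat).
Variables (f : 'rV[R]_M -> R) (X : T -> 'rV[R]_M) (mu delta sigma varpi tau : R).
Hypothesis df : twice_differentiable f.
Hypothesis mX : forall j, measurable_fun setT (fun t => X t 0 j).

Lemma measurable_large_gradient :
  measurable (X @^-1` large_gradient f mu delta sigma varpi).
Proof.
have mg : measurable_fun setT (fun t => enorm (grad f (X t)) ^+ 2).
  apply: measurable_funX; apply: measurable_enorm => i j; rewrite ord1.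
  exact: measurable_grad.
have := mg measurableT _ (measurable_itv
  `[mu * (c2 delta sigma / c1 mu delta) * (1 + varpi^-1), +oo[).
rewrite setTI; congr (measurable _).
by apply/seteqP; split => t /=; rewrite /large_gradient /= in_itv/= andbT.
Qed.

Lemma measurable_second_order_stationary : 0 < tau ->
  measurable (X @^-1` second_order_stationary f mu delta sigma varpi tau).
Proof.
move=> tau0; apply: measurableI.
  by apply: measurableC; exact: measurable_large_gradient.
by apply: measurable_lambda_min => // i j; exact: measurable_hessian.
Qed.

End partition_measurability.

Lemma higher_order_le (R : realType) (eta : R -> R) :
  higher_order_than_mu4 eta ->
  exists2 e : R, 0 < e & forall mu, 0 < mu -> mu < e -> eta mu <= mu ^+ 4.
Proof.
move=> /eqoP/(_ 1 ltr01) /nbhs_ballP[e /= e0 he]; exists e => // mu mu0 mue.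
have /= := he mu _ mu0; rewrite /ball/= sub0r normrN gtr0_norm// => /(_ mue).
by rewrite mul1r (ger0_norm (exprn_ge0 4 (ltW mu0))); exact: le_trans (ler_norm _).
Qed.

(** The condition is on time i + 1 but the disagreement enters at time i, which costs a factor 1 /
    rho. Multiplying by the negative [ln rho] reverses the inequality. *)
Lemma sufficient_iterations_decay (R : realType) (rho v : R) (i : nat) :
  0 <= rho -> rho < 1 -> 0 < v -> sufficient_iterations rho v i.+1 ->
  rho ^+ i <= v / rho.
Proof.
move=> r0 r1 v0; rewrite /sufficient_iterations; case: eqP => [->|/eqP rn0].
  (* If rho = 0, then i >= 1 and both sides are 0, the inverse of 0 being 0. *)
  by case: i => // i _; rewrite expr0n invr0 mulr0.
have rp : 0 < rho by rewrite lt0r rn0.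
have lr : ln rho < 0 by rewrite ln_lt0// rp.
rewrite ler_ndivrMr// => h.
rewrite ler_pdivlMr// -exprSr -ler_ln ?posrE ?exprn_gt0// lnXn// -mulr_natl.
exact: h.
Qed.

Theorem theorem2 (R : realType) (M N : nat) (M_gt0 : (0 < M)%N)
  (J : 'I_N -> 'rV[R]_M -> R) (neighbor : rel 'I_N) (A : 'M[R]_N) (p : 'cV[R]_N)
  (delta G sigma varpi tau : R)
  (eps : R) (Jo : 'M[R[i]]_N.-1) (eta : R -> R)
  (d : measure_display) (T : measurableType d) (P : probability T R)
  (ghat : nat -> 'I_N -> 'rV[R]_M -> T -> 'rV[R]_M) (w0 : 'I_N -> T -> 'rV[R]_M)
  (J_diff : forall k, twice_differentiable (J k))
  (A_comb : combination_matrix neighbor A)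
  (A_conn : strongly_connected A)
  (p_perron : perron_vector A p)
  (J_lip : lipschitz_gradients J delta)
  (J_dis : bounded_disagreement J G)
  (varpi_gt0 : 0 < varpi) (varpi_lt1 : varpi < 1) (tau_gt0 : 0 < tau)
  (w0_init : initial_iterate P w0)
  (Jo_jordan : jordan_remainder A Jo)
  (eps_gt0 : 0 < eps)
  (eps_small : spectral_norm (jordan_eps eps Jo)^T < 1)
  (eta_gt0 : forall mu : R, 0 < mu -> 0 < eta mu)
  (eta_o : higher_order_than_mu4 eta) :
  exists C mu0 : R, 0 < mu0 /\
    forall mu : R, 0 < mu -> mu < mu0 ->
    let w := diffusion A ghat w0 mu in
    gradient_noise P J ghat w sigma ->
    forall i : nat, (0 < i)%N ->
    sufficient_iterations (spectral_norm (jordan_eps eps Jo)^T) (eta mu) i ->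
    let Jagg := aggregate p J in
    let wc j := centroid p (w j) in
    let inG := wc i.-1 @^-1` large_gradient Jagg mu delta sigma varpi in
    let inM := wc i.-1 @^-1` second_order_stationary Jagg mu delta sigma varpi tau in
    (P inG != 0%E ->
       (exp_given P (Jagg \o wc i) inG <=
        exp_given P (Jagg \o wc i.-1) inG
          + (- (mu ^+ 2 * (c2 delta sigma / varpi))
             + C * mu ^+ 3 / fine (P inG))%:E)%E) /\
    (P inM != 0%E ->
       (exp_given P (Jagg \o wc i) inM <=
        exp_given P (Jagg \o wc i.-1) inM
          + (mu ^+ 2 * c2 delta sigma + C * mu ^+ 3 / fine (P inM))%:E)%E).
Proof.
have [k0 _] : exists k : 'I_N, True.
  have [_ p1 _] := p_perron.
  case: (pickP 'I_N) => [k _|h0]; first by exists k.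
  by move: p1; rewrite big1 => [/eqP|k]; [rewrite eq_sym oner_eq0|have := h0 k].
have delta_ge0 : 0 <= delta.
  (* The sign of [delta] follows from the Lipschitz bound between a basis vector and 0. *)
  pose x : 'rV[R]_M := delta_mx 0 (Ordinal M_gt0).
  have xp : 0 < enorm x.
    rewrite lt0r enorm_ge0 andbT; apply/eqP => /enorm_eq0/matrixP/(_ 0 (Ordinal M_gt0)).
    by rewrite !mxE !eqxx => /eqP; rewrite oner_eq0.
  have := le_trans (enorm_ge0 _) (J_lip k0 x 0).
  by rewrite subr0 pmulr_lge0.
have G_ge0 : 0 <= G := le_trans (enorm_ge0 _) (J_dis k0 k0 0).
have [_ A_stoch _] := A_comb.
set rho := spectral_norm _ in eps_small *.
have rho_ge0 : 0 <= rho := spectral_norm_ge0 _.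
have [n [Q [S [Q1 SQ Q_contr]]]] :=
  consensus_contraction A_stoch p_perron Jo_jordan eps_gt0 eps_small.
have [e0 e0_gt0 eta_le] := higher_order_le eta_o.
pose Y0 := \int[P]_t (enorm (Q *m \matrix_k w0 k t) ^+ 2).
have Y0_ge0 : 0 <= Y0 by apply: Rintegral_ge0 => t _; exact: sqr_ge0.
pose D := disagreement_drift G sigma Q rho.
(* Bounds the mean-square disagreement divided by mu^2: the first term is the initial disagreement,
   after rho^i <= mu^2 / rho, the second the accumulated drift. *)
pose K := Y0 / rho + D / (1 - rho).
pose a := enorm Q * N%:R * delta * enorm S.
have a_ge0 : 0 <= a by rewrite !mulr_ge0 ?enorm_ge0.
have rho1 : 0 < 1 - rho by rewrite subr_gt0.
exists ((delta * enorm S) ^+ 2 / 2 * K).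
(* The three bounds give in turn eta mu <= mu^4, the smallness asked by [perturbed_contraction_sq],
   and 4 mu (delta + 1) < 1, whence mu <= 1 and c_1 > 0. Adding 1 to [a] and [delta] avoids dividing
   by 0. *)
exists (Num.min e0 (Num.min ((1 - rho) / 8 / (a + 1)) (4 * (delta + 1))^-1)); split.
  by rewrite !lt_min e0_gt0 /= divr_gt0 ?divr_gt0 ?invr_gt0 ?mulr_gt0//; lra.
move=> mu mu_gt0; rewrite !lt_min => /and3P[mu_e0 mu_a mu_d] w w_noise [//|i] _ hi.
move=> Jagg wc inG inM.
have mu_small : mu * a <= (1 - rho) / 8.
  move: mu_a; rewrite ltr_pdivlMr; last lra.
  by nra.
have mu_delta : 4 * mu * (delta + 1) < 1.
  move: mu_d; rewrite -[_^-1]mul1r ltr_pdivlMr; last by rewrite mulr_gt0//; lra.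
  by nra.
have mu_delta1 : 2 * mu * delta <= 1 by nra.
have mu_lt1 : mu <= 1 by nra.
have Jdiff := aggregate_twice_differentiable p J_diff.
have Jlip x y : enorm (grad Jagg x - grad Jagg y) <= delta * enorm (x - y).
  exact: (aggregate_lipschitz J_diff p_perron J_lip).
have dec : \int[P]_t (disagreement A ghat w0 mu Q i t ^+ 2) <= K * mu ^+ 2.
  apply: le_trans (disagreement_moment J_diff p_perron J_lip J_dis delta_ge0 w0_init
    mu_gt0 w_noise SQ Q1 rho_ge0 eps_small Q_contr G_ge0 mu_small i) _.
  rewrite [leRHS]mulrDl lerD2r.
  have := sufficient_iterations_decay rho_ge0 eps_small (eta_gt0 mu mu_gt0) hi.
  move=> /le_trans h.
  (* Of mu^4 only mu^2 is kept, as mu <= 1. *)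
  have : rho ^+ i <= mu ^+ 2 / rho.
    apply: h; rewrite ler_wpM2r ?invr_ge0// (le_trans (eta_le mu mu_gt0 mu_e0))//.
    by rewrite ler_wiXn2l// ltW.
  by move=> /(ler_wpM2r Y0_ge0); rewrite -/Y0; lra.
have main B kappa : history w i B ->
    (forall t, B t -> kappa <= mu / 2 * enorm (grad Jagg (wc i t)) ^+ 2) ->
    P B != 0%E ->
    (exp_given P (Jagg \o wc i.+1) B <= exp_given P (Jagg \o wc i) B
      + (mu ^+ 2 * c2 delta sigma - kappa
         + (delta * enorm S) ^+ 2 / 2 * K * mu ^+ 3 / fine (P B))%:E)%E.
  move=> hB hk PB.
  have mB := history_sub J_diff J_lip delta_ge0 w0_init w_noise hB.
  have ic j : rint P (Jagg \o wc j).
    apply: (rint_cost Jdiff delta_ge0 Jlip) => m.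
    exact: (centroid_sqint p J_diff J_lip delta_ge0 w0_init w_noise).
  apply: exp_given_le => //.
  apply: le_trans (descent_on_event J_diff p_perron J_lip delta_ge0 w0_init
    mu_gt0 w_noise SQ mu_delta1 hB hk) _.
  rewrite lerD2l.
  have c0 : 0 <= mu / 2 * (delta * enorm S) ^+ 2.
    by rewrite mulr_ge0 ?sqr_ge0// divr_ge0// ltW.
  apply: le_trans (ler_wpM2l c0 dec) _.
  by rewrite le_eqVlt; apply/orP; left; apply/eqP; ring.
(* The centroid is measurable for the past, so the measurability lemmas of the partition, taken with
   the past as ambient sigma-algebra, make both sets events of the past. *)
have mwc j : measurable_fun [set: g_sigma_algebraType (history_gen w i)]
    (fun t => wc i t 0 j) by exact: centroid_history.
split=> PB.
  have hB : history w i inG.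
    exact: (@measurable_large_gradient _ _ (g_sigma_algebraType (history_gen w i))).
  have c1_gt0 : 0 < c1 mu delta by rewrite /c1; lra.
  (* This [kappa] is mu c_1 times the threshold of the large-gradient set; it is a valid lower bound
     because c_1 <= 1/2. *)
  have := main inG (mu ^+ 2 * c2 delta sigma * (1 + varpi^-1)) hB _ PB.
  have -> : mu ^+ 2 * c2 delta sigma - mu ^+ 2 * c2 delta sigma * (1 + varpi^-1)
    = - (mu ^+ 2 * (c2 delta sigma / varpi)) by ring.
  apply; move=> t; rewrite /inG /= /large_gradient /= => h.
  have c0 : 0 <= mu * c1 mu delta by rewrite mulr_ge0// ltW.
  have := ler_wpM2l c0 h.
  have -> : mu * c1 mu delta * (mu * (c2 delta sigma / c1 mu delta) * (1 + varpi^-1))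
     = mu ^+ 2 * c2 delta sigma * (1 + varpi^-1).
    by field; rewrite !gt_eqF.
  move=> /le_trans; apply; rewrite ler_wpM2r ?sqr_ge0// ler_wpM2l ?(ltW mu_gt0)//.
  by rewrite /c1; nra.
have hB : history w i inM.
  exact: (@measurable_second_order_stationary _ _ (g_sigma_algebraType (history_gen w i))).
(* Here the gradient term is merely nonnegative, so [kappa] is 0. *)
have := main inM 0 hB _ PB; rewrite subr0; apply => t _.
by rewrite mulr_ge0 ?sqr_ge0// divr_ge0// ltW.
Qed.
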